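(* Let $\rho\in(-1,1)$, and for $n\ge1$ let $(X_n,Y_n)$ be equal in distribution to $(R\cos\Theta,\ \rho R\cos\Theta+\sqrt{1-\rho^2}\,R\sin\Theta)$, where $R>0$ has distribution function $F$ with upper endpoint $x_F$ and is independent of the random angle $\Theta\in(-\pi,\pi)$, which has a positive density function $h$ on $(-\pi,\pi)$ (not depending on $n$) with $h(\theta)=h(-\theta)$ for all $\theta\in[0,\pi/2)$. Suppose that $F$ satisfies Assumption A1 (see context) with scaling function $w$, and that $h$ is regularly varying at $0$ with index $2\delta\in(-1,\infty)$. Then for any positive sequence $u_n<x_F$, $n\ge1$, such that $\lim_{n\to\infty}u_n=x_F$, with $t_n:=u_nw(u_n)$, the following hold. (i) As $n\to\infty$, $$\mathbf P\{X_n>u_n\}=(1+o(1))\,2^{\delta+1/2}\,\Gamma(\delta+1/2)\,t_n^{-1/2}\,h(\sqrt{1/t_n})\,[1-F(u_n)],$$ and $X_1$ has distribution function in the max-domain of attraction of the Gumbel distribution with the scaling function $w$. (ii) For any sequence of positive constants $q_n$, $n\ge1$, such that $\lim_{n\to\infty}w(u_n)/q_n=\infty$, $$q_n\,|R\cos(\Theta)-u_n|\ \Big|\ R\cos(\Theta)>u_n\ \stackrel{p}{\to}\ 0,\qquad n\to\infty,$$ i.e. $\mathbf P\{q_n|R\cos(\Theta)-u_n|>\varepsilon\mid R\cos(\Theta)>u_n\}\to0$ for every $\varepsilon>0$. (iii) For any given constants $x>0$, $y\in\mathbb R$, $$\lim_{n\to\infty}\mathbf P\Big\{Y_n\le\rho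 u_n+y\,u_n/\sqrt{t_n},\ X_n\le u_n+x/w(u_n)\ \Big|\ X_n>u_n\Big\}=\mathbf P\big\{Z\le y/\sqrt{1-\rho^2},\ W\le x\big\},$$ where $Z$ is symmetric about $0$ with $Z^2\sim\Psi_{\delta+1/2,1/2}$, and $Z$ is independent of $W\sim\Psi_{1,1}$.
   Context: Assumption A1: $F$ has upper endpoint $x_F\in(0,\infty]$, $F(0)=0$, and $F$ is in the Gumbel max-domain of attraction with a positive scaling function $w$. A distribution function $H$ with upper endpoint $x_H$ is in the Gumbel max-domain of attraction with scaling function $w$ if $\lim_{u\uparrow x_H}\frac{1-H(u+x/w(u))}{1-H(u)}=\exp(-x)$ for all $x\in\mathbb R$. $h$ regularly varying at $0$ with index $2\delta$ means $\lim_{t\downarrow0}h(ts)/h(t)=s^{2\delta}$ for all $s>0$. $\Psi_{\alpha,\beta}$, $\alpha,\beta>0$, denotes the Gamma distribution with density $x^{\alpha-1}\exp(-\beta x)\beta^{\alpha}/\Gamma(\alpha)$, $x\in(0,\infty)$, where $\Gamma(\cdot)$ is the Gamma function. *)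

(* Defs.v *)
From HB Require Import structures.
From mathcomp Require Import all_boot all_order all_algebra.
From mathcomp Require Import all_classical all_reals all_analysis.

Set Implicit Arguments.
Unset Strict Implicit.
Unset Printing Implicit Defensive.

Import Order.TTheory GRing.Theory Num.Theory.
Import numFieldNormedType.Exports.

Local Open Scope classical_set_scope.
Local Open Scope ring_scope.

Section real_functions.
Context {R : realType}.

Definition upper_endpoint (H : R -> R) : \bar R :=
  ereal_sup [set x%:E | x in [set x | H x < 1]].

(* The filter of u increasing to a, for a finite or a = +oo.  The case a = -oo
   is a dummy: the upper endpoint of a distribution function is never -oo. *)
Definition increasing_to (a : \bar R) : set_system R :=
  if a is r%:E then r^'- else pinfty_nbhs R.

Definition gumbel_mda (H w : R -> R) : Prop :=
  forall x : R,
    (1 - H (u + x / w u)) / (1 - H u) @[u --> increasing_to (upper_endpoint H)]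
      --> expR (- x).

Definition regularly_varying_at0 (h : R -> R) (index : R) : Prop :=
  forall s : R, 0 < s -> h (t * s) / h t @[t --> 0^'+] --> s `^ index.

Definition Gamma_fun (a : R) : R :=
  \int[lebesgue_measure]_(x in `]0, +oo[) (x `^ (a - 1) * expR (- x)).

Definition gamma_pdf (a b : R) : R -> R :=
  (fun x => x `^ (a - 1) * expR (- b * x) * b `^ a / Gamma_fun a) \_ `]0, +oo[.

End real_functions.

Section random_elements.
Context {R : realType}.

(* Real-valued version of the library's [cdf]. *)
Definition dfun d (T : measurableType d) (P : probability T R)
    (X : {RV P >-> R}) (x : R) : R := fine (cdf X x).

Definition equal_in_law d1 d2 d' (T1 : measurableType d1)
    (T2 : measurableType d2) (E : measurableType d')
    (P1 : probability T1 R) (f1 : T1 -> E)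
    (P2 : probability T2 R) (f2 : T2 -> E) : Prop :=
  forall A : set E, measurable A -> pushforward P1 f1 A = pushforward P2 f2 A.

Definition has_density d (T : measurableType d) (P : probability T R)
    (X : T -> R) (f : R -> R) : Prop :=
  forall A : set R, measurable A ->
    pushforward P X A = (\int[lebesgue_measure]_(x in A) (f x)%:E)%E.

Definition independent_rv d (T : measurableType d) (P : probability T R)
    (X Y : T -> R) : Prop :=
  forall A B : set R, measurable A -> measurable B ->
    (P (X @^-1` A `&` Y @^-1` B) = P (X @^-1` A) * P (Y @^-1` B))%E.

(* P(A | B); only meaningful when P B is nonzero. *)
Definition cond_prob d (T : measurableType d) (P : probability T R)
    (A B : set T) : R := fine (P (A `&` B)) / fine (P B).

End random_elements.

(* Main.v *)
Require Import Defs.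
From HB Require Import structures.
From mathcomp Require Import all_boot all_order all_algebra.
From mathcomp Require Import all_classical all_reals all_analysis.
From mathcomp Require Import measurable_realfun ring lra.

Set Implicit Arguments.
Unset Strict Implicit.
Unset Printing Implicit Defensive.

Import Order.TTheory GRing.Theory Num.Theory.
Import numFieldNormedType.Exports.

Local Open Scope classical_set_scope.
Local Open Scope ring_scope.

(** The idea is that the exceedance [R cos Theta > u] forces [Theta] to be of the
order of [tau = t^(-1/2)], where [t = u w(u)] tends to infinity: at the angle [s tau]
the radius has to exceed [u / cos (s tau) = u + (s^2/2 + o(1)) / w(u)], which has
probability about [e^(-s^2/2) P(R > u)] by the Gumbel property of the radius.  Write
[V(x) = P(0 < Theta <= x)] and [b = delta + 1/2].  Integrating the regular variation
of the density shows that [V(s tau) / V(tau)] tends to [s^(2b)]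
([distribution_regularly_varying]).  Hence, for the upper half plane,
[P(R cos Theta > u + a/w(u), 0 < Theta <= s tau) / (V(tau) P(R > u))] tends to
[e^(-a) I(s)], where [I(s)] is the integral of [e^(-v^2/2) d(v^(2b))] over [0, s], an
incomplete Gamma function ([exceedance_sector_limit]).  No uniformity is needed for
this: the radial tail is monotone and the angular factor is a measure, so that
independence and a uniform grid of sectors suffice ([stieltjes_limit]).

The angles beyond [s tau] contribute little ([exceedance_wide_sector]).  Iterating one
step [u + 1/w(u)] of the Gumbel property gives a decay of the radial tail by [2^-k] at
the distance [(1 + c + ... + c^(k-1)) / w(u)], uniformly in [k] and for [c] as close
to 1 as desired ([gumbel_geometric]); a corresponding geometric partition of the
angles has masses growing at most like [(3/2)^k], and the series of the products
converges.  So [s] may be replaced by infinity ([exceedance_limit]).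

The reflected angle has the same law near 0, which gives the lower half plane
([exceedance_below_limit], [exceedance_total_limit]).  Karamata's theorem for the
density, [x h(x) / V(x) -> 2b] ([karamata]), turns [V(tau)] into [tau h(tau) / (2b)]
and yields the asymptotics of the exceedance probability.  The factor [e^(-a)] is the
Gumbel property of [R cos Theta], and implies that the exceedance is of the order
[1/w(u)].  Finally, on the event that [R cos Theta] lies in [(u, u + x/w(u)]], the
second coordinate is compared with the level through [tan Theta], which is
asymptotically [Theta]: the joint event lies between two sectors whose limits are
arbitrarily close ([joint_event_limit]), and its limit is the product of an
exponential and a symmetric law whose square is Gamma ([symmetric_gamma_cdf]). *)

(** * Tails in the Gumbel domain of attraction *)

(** Both cases of [increasing_to] are generated by the sets x0 < u < a. *)
Lemma increasing_toP {R : realType} (a : \bar R) (A : set R) : (-oo < a)%E ->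
  increasing_to a A <->
  exists2 x0 : R, (x0%:E < a)%E & forall u, x0 < u -> (u%:E < a)%E -> A u.
Proof.
case: a => [r _|_|//].
- split.
  + case=> e /= e0 eA; exists (r - e); first by rewrite lte_fin ltrBlDr ltrDl.
    move=> u ur; rewrite lte_fin => ur'; apply: eA => //=.
    by rewrite ger0_norm ?subr_ge0 ?ltW// ltrBlDr -ltrBlDl.
  + case=> x0; rewrite lte_fin => x0r H.
    exists (r - x0); rewrite /= ?subr_gt0// => u /= uB ur.
    apply: H; last by rewrite lte_fin.
    by move: uB; rewrite ger0_norm ?subr_ge0 ?ltW// ltrD2l ltrN2.
- split.
  + by case=> M [_ HM]; exists M; rewrite ?ltry// => u uM _; exact: HM.
  + case=> x0 _ H; exists x0; split; first exact: num_real.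
    by move=> u x0u; apply: H => //; rewrite ltry.
Qed.

Lemma increasing_to_filter {R : realType} (a : \bar R) :
  (-oo < a)%E -> ProperFilter (increasing_to a).
Proof. by case: a => [r _|_|//] /=; exact: _. Qed.

Lemma near_eq_cvg_to {T : Type} {R : realType} (F : set_system T)
    {FF : Filter F} (f g : T -> R) (l : R) :
  (\forall x \near F, f x = g x) -> f x @[x --> F] --> l -> g x @[x --> F] --> l.
Proof. by move=> fg fl; apply: cvg_trans fl; exact: near_eq_cvg. Qed.

Lemma expRN1_lt_half (R : realType) : expR (- 1) < 1 / 2 :> R.
Proof.
rewrite expRN div1r ltf_pV2 ?posrE ?expR_gt0//.
by have := @expR_gt1Dx R 1 (oner_neq0 _).
Qed.

(** What is used of the radius: G is its survival function, equal to 1 at 0 because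
the radius is positive. *)
Record gumbel_tail {R : realType} (xF : \bar R) (G w : R -> R) : Prop := GumbelTail {
  endpoint_gt0 : (0 < xF)%E ;
  tail_nonincreasing : forall x y, x <= y -> G y <= G x ;
  tail_ge0 : forall u, 0 <= G u ;
  tail_gt0 : forall u, (u%:E < xF)%E -> 0 < G u ;
  tail_endpoint : forall u, 0 < G u -> (u%:E <= xF)%E ;
  tail_at0 : G 0 = 1 ;
  scale_gt0 : forall u, (u%:E < xF)%E -> 0 < w u ;
  tail_gumbel : forall x, G (u + x / w u) / G u @[u --> increasing_to xF]
     --> expR (- x) }.

Section gumbel_tail.
Context {R : realType} (xF : \bar R) (G w : R -> R) (tailG : gumbel_tail xF G w).
Let xF_gt0 := endpoint_gt0 tailG.
Let G_ni := tail_nonincreasing tailG.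
Let G_ge0 := tail_ge0 tailG.
Let G_gt0 := tail_gt0 tailG.
Let G_le_endpoint := tail_endpoint tailG.
Let G_at0 := tail_at0 tailG.
Let w_gt0 := scale_gt0 tailG.
Let G_gumbel := tail_gumbel tailG.
Arguments G_gumbel : clear implicits.

Let xF_Ny : (-oo < xF)%E. Proof. exact: lt_trans xF_gt0. Qed.

Let FF := increasing_to_filter xF_Ny.
#[local] Existing Instance FF.

Lemma near_lt_endpoint : \forall u \near increasing_to xF, (u%:E < xF)%E.
Proof. by apply/increasing_toP => //; exists 0. Qed.

Lemma near_gt_lower (x : R) : (x%:E < xF)%E ->
  \forall u \near increasing_to xF, x < u.
Proof. by move=> xx; apply/increasing_toP => //; exists x. Qed.

Lemma near_arg_gt0 : \forall u \near increasing_to xF, 0 < u.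
Proof. exact: near_gt_lower. Qed.

Lemma near_G_gt0 : \forall u \near increasing_to xF, 0 < G u.
Proof. by apply: filterS near_lt_endpoint => u; exact: G_gt0. Qed.

(** The tail vanishes beyond the endpoint, whereas the ratio at a + 1 has a positive
limit. *)
Lemma near_step_lt (a : R) :
  \forall u \near increasing_to xF, ((u + a / w u)%:E < xF)%E.
Proof.
have := cvgr_gt _ (G_gumbel (a + 1)) _ (expR_gt0 (- (a + 1))).
move=> H; near=> u.
have Gu : 0 < G (u + (a + 1) / w u) / G u by near: u; exact: H.
have w0 : 0 < w u by apply: w_gt0; near: u; exact: near_lt_endpoint.
have G0 : 0 < G u by near: u; exact: near_G_gt0.
apply: (@lt_le_trans _ _ ((u + (a + 1) / w u)%:E)).
  by rewrite lte_fin ltrD2l ltr_pM2r ?invr_gt0// ltrDl.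
apply: G_le_endpoint.
by move: Gu; rewrite pmulr_lgt0// invr_gt0.
Unshelve. all: by end_near. Qed.

(** A step from u to u + 1/w u stays below the endpoint and more than halves G, which
excludes a positive infimum. *)
Lemma G_cvg0 : G u @[u --> increasing_to xF] --> 0.
Proof.
pose p := inf [set G u | u in [set u | (u%:E < xF)%E]].
have hI : has_inf [set G u | u in [set u | (u%:E < xF)%E]].
  split; first by exists (G 0), 0.
  by exists 0 => _ [u _ <-].
have pG u : (u%:E < xF)%E -> p <= G u.
  by move=> ux; apply: ge_inf; [case: hI|exists u].
have e1 : expR (- 1) < 1 / 2 :> R := expRN1_lt_half R.
have p0 : p <= 0.
  rewrite leNgt; apply/negP => p0.
    have [_ [x xx <-] Gx] : exists2 y, [set G u | u in [set u | (u%:E < xF)%E]] y & y < p + p / 4.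
      by apply: inf_adherent => //; lra.
    have : \forall u \near increasing_to xF, [/\ x < u, G (u + 1 / w u) / G u < 1 / 2, (u%:E < xF)%E & ((u + 1 / w u)%:E < xF)%E].
      near=> u; split; near: u.
      - exact: near_gt_lower.
      - by apply: (cvgr_lt _ (G_gumbel 1)).
      - exact: near_lt_endpoint.
      - exact: near_step_lt.
    move=> /filter_ex[u [xu Gu ux ux']].
    have Gu0 := G_gt0 ux.
    move: Gu; rewrite ltr_pdivrMr// => Gu.
    have := pG _ ux'; have := G_ni (ltW xu); lra.
have p00 : p = 0.
  by apply/eqP; rewrite eq_le p0/=; apply: lb_le_inf; [case: hI|move=> _ [u _ <-]].
apply/cvgrPdist_lt => e e0.
have [_ [x xx <-] Gx] : exists2 y, [set G u | u in [set u | (u%:E < xF)%E]] y & y < p + e.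
  by apply: inf_adherent.
near=> u; rewrite sub0r normrN ger0_norm//.
rewrite (@le_lt_trans _ _ (G x))//; last by move: Gx; rewrite p00 add0r.
by apply/G_ni/ltW; near: u; exact: near_gt_lower.
Unshelve. all: by end_near. Qed.

(** If u w(u) <= B, then u - B/w(u) <= 0, where the tail equals 1: the ratio at -B is
1 / G(u), which is unbounded, whereas it tends to e^B. *)
Lemma uw_cvgy : u * w u @[u --> increasing_to xF] --> +oo.
Proof.
apply/cvgryPgt => A.
pose B := Num.max A 1.
near=> u; rewrite (@le_lt_trans _ _ B)// ?le_max ?lexx//.
have w0 : 0 < w u by apply: w_gt0; near: u; exact: near_lt_endpoint.
have Gu : 0 < G u by near: u; exact: near_G_gt0.
rewrite ltNge; apply/negP => uB.
have : G (u + - B / w u) / G u < expR B + 1.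
  by near: u; apply: (cvgr_lt _ (G_gumbel (- B))); rewrite opprK ltrDl.
apply/negP; rewrite -leNgt ler_pdivlMr//.
have uB0 : u + - B / w u <= 0.
  by rewrite mulNr subr_le0 ler_pdivlMr.
apply: le_trans (G_ni uB0); rewrite G_at0.
rewrite -ler_pdivlMl ?ltr_wpDl// ?expR_ge0// mulr1.
near: u; apply: (cvgr_le _ G_cvg0).
by rewrite invr_gt0 ltr_wpDl// expR_ge0.
Unshelve. all: by end_near. Qed.

(** Convergence of the monotone functions [x |-> G (u + x / w u) / G u] to a
continuous limit is locally uniform. *)
Lemma gumbel_uniform (x : R -> R) (l : R) :
  x u @[u --> increasing_to xF] --> l ->
  G (u + x u / w u) / G u @[u --> increasing_to xF] --> expR (- l).
Proof.
move=> xl; apply/cvgrPdist_le => e e0.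
have : expR (- z) @[z --> l] --> expR (- l).
  by apply: continuous_comp; [exact: opp_continuous|exact: continuous_expR].
move=> /cvgrPdist_lt/(_ (e / 2)).
rewrite divr_gt0// => /(_ isT)[r/= r0 Hr].
have H1 : `|expR (- l) - expR (- (l - r / 2))| < e / 2.
  by apply: Hr; rewrite /= opprB addrCA subrr addr0 gtr0_norm ?divr_gt0// ltr_pdivrMr// ltr_pMr// ltr1n.
have H2 : `|expR (- l) - expR (- (l + r / 2))| < e / 2.
  by apply: Hr; rewrite /= opprD addrA subrr sub0r normrN gtr0_norm ?divr_gt0// ltr_pdivrMr// ltr_pMr// ltr1n.
near=> u.
have w0 : 0 < w u by apply: w_gt0; near: u; exact: near_lt_endpoint.
have Gu : 0 < G u by near: u; exact: near_G_gt0.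
have H3 : `|expR (- (l - r / 2)) - G (u + (l - r / 2) / w u) / G u| < e / 2.
  by near: u; apply: (cvgr_dist_lt _ _ (G_gumbel _)); rewrite divr_gt0.
have H4 : `|expR (- (l + r / 2)) - G (u + (l + r / 2) / w u) / G u| < e / 2.
  by near: u; apply: (cvgr_dist_lt _ _ (G_gumbel _)); rewrite divr_gt0.
have xu1 : l - r / 2 <= x u.
  by near: u; apply: (cvgr_ge _ xl); rewrite ltrBlDr ltrDl divr_gt0.
have xu2 : x u <= l + r / 2.
  by near: u; apply: (cvgr_le _ xl); rewrite ltrDl divr_gt0.
have Hu1 : G (u + x u / w u) / G u <= G (u + (l - r / 2) / w u) / G u.
  by rewrite ler_pM2r ?invr_gt0//; apply: G_ni; rewrite lerD2l ler_pM2r ?invr_gt0.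
have Hu2 : G (u + (l + r / 2) / w u) / G u <= G (u + x u / w u) / G u.
  by rewrite ler_pM2r ?invr_gt0//; apply: G_ni; rewrite lerD2l ler_pM2r ?invr_gt0.
move: H1 H2 H3 H4; rewrite !ltr_norml ler_norml => /andP[? ?] /andP[? ?] /andP[? ?] /andP[? ?].
by apply/andP; split; lra.
Unshelve. all: by end_near. Qed.

(** The scaling function is self-neglecting.  With v = u + 1/w u, the tail at
v + 1/w v is equivalent to e^-2 G u, hence that point cannot lie beyond
u + (1 + c)/w u, where the tail is equivalent to e^-(1 + c) G u. *)
Lemma near_step (c : R) : 1 < c -> \forall u \near increasing_to xF,
  [/\ ((u + 1 / w u)%:E < xF)%E, G (u + 1 / w u) <= G u / 2 &
      1 / w (u + 1 / w u) <= c / w u].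
Proof.
move=> c1.
have e1 : expR (- 1) < 1 / 2 :> R := expRN1_lt_half R.
have vcvg : (u + 1 / w u) @[u --> increasing_to xF] --> increasing_to xF.
  move=> A /= /(increasing_toP _ xF_Ny)[x0 x0F HA].
  change (\forall u \near increasing_to xF, A (u + 1 / w u)).
  near=> u; apply: HA; last by near: u; exact: near_step_lt.
  have w0 : 0 < w u by apply: w_gt0; near: u; exact: near_lt_endpoint.
  apply: (@lt_trans _ _ u); first by near: u; exact: near_gt_lower.
  by rewrite ltrDl divr_gt0.
have Hv : G (u + 1 / w u + 1 / w (u + 1 / w u)) / G u
    @[u --> increasing_to xF] --> expR (- 2).
  have -> : expR (- 2) = expR (- 1) * expR (- 1) :> R.
    by rewrite -expRD; congr expR; lra.
  have H1 : G (u + 1 / w u + 1 / w (u + 1 / w u)) / G (u + 1 / w u)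
      @[u --> increasing_to xF] --> expR (- 1).
    exact: (cvg_comp _ _ vcvg (G_gumbel 1)).
  apply: near_eq_cvg_to (cvgM H1 (G_gumbel 1)); near=> u => /=.
  have Gu : G u != 0 by rewrite gt_eqF//; near: u; exact: near_G_gt0.
  have Gv : G (u + 1 / w u) != 0.
    by rewrite gt_eqF//; apply: G_gt0; near: u; exact: near_step_lt.
  by field; apply/andP.
pose r := expR (- ((3 + c) / 2)) : R.
near=> u.
have w0 : 0 < w u by apply: w_gt0; near: u; exact: near_lt_endpoint.
have Gu : 0 < G u by near: u; exact: near_G_gt0.
split.
- by near: u; exact: near_step_lt.
- rewrite [leRHS]mulrC -ler_pdivrMr// -[2^-1]div1r.
  by near: u; apply: (cvgr_le _ (G_gumbel 1)).
- have H1 : G (u + (1 + c) / w u) / G u < r.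
    by near: u; apply: (cvgr_lt _ (G_gumbel _)); rewrite ltr_expR; lra.
  have H2 : r < G (u + 1 / w u + 1 / w (u + 1 / w u)) / G u.
    by near: u; apply: (cvgr_gt _ Hv); rewrite ltr_expR; lra.
  rewrite leNgt; apply/negP => H.
  have : G (u + 1 / w u + 1 / w (u + 1 / w u)) / G u <= G (u + (1 + c) / w u) / G u.
    rewrite ler_pM2r ?invr_gt0//; apply: G_ni.
    by rewrite mulrDl addrA lerD2l ltW.
  by rewrite leNgt (lt_trans H1 H2).
Unshelve. all: by end_near. Qed.

(** Iterating [near_step]: k steps lead at most to u + (1 + c + ... + c^(k-1))/w u.
The resulting decay dominates the growth of the angular masses in the tail estimate. *)
Lemma gumbel_geometric (c : R) : 1 < c -> \forall u \near increasing_to xF,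
  forall k : nat, G (u + ((c ^+ k - 1) / (c - 1)) / w u) <= G u / 2 ^+ k.
Proof.
move=> c1; have /(increasing_toP _ xF_Ny)[x0 x0F H] := near_step c1.
apply/increasing_toP => //; exists x0 => // u x0u uF k.
elim: k u x0u uF => [u _ _|k IH u x0u uF].
  by rewrite !expr0 subrr !mul0r addr0 divr1.
have [vF Gv wv] := H _ x0u uF.
have w0 := w_gt0 uF; have wv0 := w_gt0 vF.
set v := u + 1 / w u in vF Gv wv wv0.
have x0v : x0 < v by rewrite (lt_trans x0u)// ltrDl divr_gt0.
have := IH _ x0v vF.
have ck : 0 <= (c ^+ k - 1) / (c - 1).
  by rewrite divr_ge0// subr_ge0 ?exprn_ege1// ltW.
have : v + ((c ^+ k - 1) / (c - 1)) / w v <= u + (c ^+ k.+1 - 1) / (c - 1) / w u.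
  have -> : (c ^+ k.+1 - 1) / (c - 1) / w u
     = 1 / w u + (c ^+ k - 1) / (c - 1) * (c / w u).
    by rewrite exprS; field; rewrite gt_eqF//= gt_eqF// subr_gt0.
  rewrite addrA lerD2l; apply: ler_wpM2l => //.
  by rewrite -[leLHS]mul1r.
move=> /G_ni h1 h2; apply: (le_trans h1); apply: (le_trans h2).
by rewrite exprS invfM mulrA ler_wpM2r ?invr_ge0 ?exprn_ge0.
Qed.

End gumbel_tail.

(** * Integrals of rescaled functions and of powers *)

Section lebesgue_scaling.
Context {R : realType}.
Local Notation mu := (@lebesgue_measure R).

(** Uniqueness of Lebesgue measure speaks of measures, hence the existential. *)
Lemma lebesgue_image_scale (c : R) :
  exists nu : {measure set (measurableTypeR R) -> \bar R},
    nu = pushforward mu ( *%R c : measurableTypeR R -> measurableTypeR R)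
      :> (set _ -> \bar R).
Proof.
have mf : measurable_fun [set: measurableTypeR R]
    ( *%R c : measurableTypeR R -> measurableTypeR R).
  exact: mulrl_measurable.
by unshelve (eexists (pushforward mu ( *%R c : measurableTypeR R -> measurableTypeR R))).
Qed.

(** The integrand is only measurable, so this rests on the image of Lebesgue measure
and not on a substitution. *)
Lemma ge0_integral_scale (c : R) (D : set R) (f : R -> \bar R) : 0 < c ->
  measurable D -> measurable_fun [set: R] f -> (forall x, (0 <= f x)%E) ->
  (\int[mu]_(x in D) f x = c%:E * \int[mu]_(x in *%R c @^-1` D) f (c * x)%R)%E.
Proof.
move=> c0 mD mf f0; have mfD : measurable_fun D f by exact: measurable_funTS.
have mg : measurable_fun [set: measurableTypeR R]
    ( *%R c : measurableTypeR R -> measurableTypeR R).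
  exact: mulrl_measurable.
have [nu nuE] := lebesgue_image_scale c.
have -> : (\int[mu]_(x in *%R c @^-1` D) f (c * x)%R = \int[nu]_(x in D) f x)%E.
  rewrite nuE.
  by symmetry; apply: (@ge0_integral_pushforward _ _ _ _ _ _ mg mu).
rewrite -(@ge0_integral_mscale _ _ _ nu _ mD (NngNum (ltW c0)))//.
apply: eq_measure_integral => A mA _.
apply: lebesgue_measure_unique => // _ [[a b]] _ <-.
change (mu `]a, b]%classic = c%:E * nu `]a, b]%classic)%E.
rewrite nuE /pushforward /=.
have -> : *%R c @^-1` `]a, b] = `]c^-1 * a, c^-1 * b]%classic.
  by apply/seteqP; split=> x /=; rewrite !in_itv/= ltr_pdivrMl// ler_pdivlMl.
rewrite !lebesgue_measure_itv/= !lte_fin ltr_pM2l ?invr_gt0//.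
case: ifPn => _; last by rewrite mule0.
by rewrite -!EFinD -EFinM -mulrBr mulrA divff ?gt_eqF// mul1r.
Qed.

End lebesgue_scaling.

Section powR_integral.
Context {R : realType}.
Local Notation mu := (@lebesgue_measure R).

Lemma powR_continuous (p x : R) : 0 < x -> y `^ p @[y --> x] --> x `^ p.
Proof.
move=> x0.
have : {for x, continuous (fun y : R => y `^ p)}; last by [].
apply: differentiable_continuous; apply/derivable1_diffP.
by apply: derivable_powR; rewrite in_itv/= x0.
Qed.

Lemma measurable_powRl (p : R) (D : set R) :
  measurable_fun D (fun x : R => x `^ p).
Proof. by apply: measurable_funTS; exact: measurable_powR. Qed.

Lemma integral_powR_pos (p a b : R) : 0 < a -> a < b ->
  (\int[mu]_(x in `]a, b]) (p * x `^ (p - 1))%:E = (b `^ p - a `^ p)%:E)%E.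
Proof.
move=> a0 ab.
have cpos x : x \in `[a, b] -> 0 < x.
  by rewrite in_itv/= => /andP[ax _]; exact: lt_le_trans ax.
rewrite integral_itv_obnd_cbnd; last first.
  by apply/measurable_EFinP; apply: measurable_funM => //; exact: measurable_powRl.
rewrite EFinB (@continuous_FTC2 _ _ (fun x => x `^ p))//.
- apply: continuous_in_subspaceT => x; rewrite inE/= => xab.
  by apply: cvgM; [exact: cvg_cst|apply: powR_continuous; exact: cpos].
- split.
  + move=> x; rewrite in_itv/= => /andP[ax _].
    by apply: derivable_powR; rewrite in_itv/= (lt_trans a0).
  + by apply: cvg_at_right_filter; apply: powR_continuous.
  + by apply: cvg_at_left_filter; apply: powR_continuous; exact: lt_trans ab.
- move=> x; rewrite in_itv/= => /andP[ax _].
  by apply: powR_derive1; rewrite in_itv/= (lt_trans a0).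
Qed.

(** The integrand may be unbounded at 0, so the range of integration is exhausted
by the intervals ]b/(n+2), b]. *)
Lemma integral_powR0 (p b : R) : 0 < p -> 0 <= b ->
  (\int[mu]_(x in `]0%R, b]) (p * x `^ (p - 1))%:E = (b `^ p)%:E)%E.
Proof.
move=> p0; rewrite le_eqVlt => /predU1P[<-|b0].
  by rewrite set_itvoc0 integral_set0 powR0 ?gt_eqF.
pose D (n : nat) : set R := `]b / n.+2%:R, b]%classic.
have UD : (`]0, b]%classic : set R) = \bigcup_n D n.
  apply/seteqP; split=> x /=.
    rewrite in_itv/= => /andP[x0 xb].
    exists (Num.bound (b / x)) => //=; rewrite /D/= in_itv/= xb andbT.
    rewrite ltr_pdivrMr// mulrC -ltr_pdivrMr//.
    have bx0 : 0 <= b / x by rewrite divr_ge0// ltW.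
    apply: (lt_le_trans (archi_boundP bx0)).
    by rewrite ler_nat -addn2 leq_addr.
  move=> [n _]; rewrite /D/= !in_itv/= => /andP[bx ->].
  by rewrite andbT (le_lt_trans _ bx)// divr_ge0// ltW.
have H : (\int[mu]_(x in D n) (p * x `^ (p - 1))%:E)%E @[n --> \oo]
    --> (\int[mu]_(x in \bigcup_n D n) (p * x `^ (p - 1))%:E)%E.
  apply: ge0_nondecreasing_set_cvg_integral.
  - move=> m n mn; rewrite subsetEset => x; rewrite /D/= !in_itv/= => /andP[bx ->].
    rewrite andbT (le_lt_trans _ bx)// ler_pM2l// lef_pV2 ?posrE//.
    by rewrite ler_nat.
  - by move=> n; exact: measurable_itv.
  - by move=> n; apply/measurable_EFinP; apply: measurable_funM => //; exact: measurable_powRl.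
  - by move=> n x _; rewrite lee_fin mulr_ge0 ?powR_ge0// ltW.
have E n : (\int[mu]_(x in D n) (p * x `^ (p - 1))%:E = (b `^ p - (b / n.+2%:R) `^ p)%:E)%E.
  by rewrite integral_powR_pos ?divr_gt0// ltr_pdivrMr// ltr_pMr// ltr1n.
rewrite UD; apply: (cvg_unique _ H) => //; rewrite (funext E).
apply: cvg_EFin; first by apply: nearW.
rewrite -[X in _ --> X]subr0.
apply: cvgB; first exact: cvg_cst.
have /cvg_at_rightP := powR_cvg0 p0; apply; split=> [n|]; first by rewrite divr_gt0.
rewrite -[X in _ --> X](mulr0 b); apply: cvgM; first exact: cvg_cst.
have := @cvg_harmonic R; rewrite -(cvg_shiftn 1).
by apply: cvg_trans; apply: near_eq_cvg; near=> n; rewrite /= addn1.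
Unshelve. all: by end_near. Qed.

End powR_integral.

Section dominated.
Context {R : realType}.
Local Notation mu := (@lebesgue_measure R).

Lemma bounded_measurable_integrable (D : set R) (f : R -> R) (M : R) :
  measurable D -> (mu D < +oo)%E -> measurable_fun D f ->
  (forall s, D s -> `|f s| <= M) -> mu.-integrable D (EFin \o f).
Proof.
move=> mD fD mf fM; apply: measurable_bounded_integrable => //.
exists M; split; first exact: num_real.
by move=> y My s Ds; exact: (le_trans (fM _ Ds) (ltW My)).
Qed.

Lemma bounded_cvg_Rintegral (D : set R) (f_ : nat -> R -> R) (f : R -> R) (M : R) :
  measurable D -> (mu D < +oo)%E ->
  (forall n, measurable_fun D (f_ n)) -> measurable_fun D f ->
  (\forall n \near \oo, forall s, D s -> `|f_ n s| <= M) ->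
  (forall s, D s -> f_ n s @[n --> \oo] --> f s) ->
  (\int[mu]_(s in D) f_ n s)%R @[n --> \oo] --> (\int[mu]_(s in D) f s)%R.
Proof.
move=> mD fD mf_ mf [N _ HN] ff.
rewrite -(cvg_shiftn N).
have [] := @dominated_convergence _ _ _ mu D mD
  (fun n s => (f_ (n + N)%N s)%:E) (EFin \o f) (cst M%:E).
- by move=> n; apply/measurable_EFinP; exact: mf_.
- exact/measurable_EFinP.
- apply: aeW => s Ds; apply: cvg_EFin; first exact: nearW.
  by rewrite (cvg_shiftn N (fun n => f_ n s)); exact: ff.
- by apply: (@bounded_measurable_integrable D (cst M) `|M|).
- by apply: aeW => s n Ds; rewrite abse_EFin lee_fin; apply: HN => //=; rewrite leq_addl.
move=> fint _ H; apply: fine_cvg.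
by rewrite /Rintegral fineK//; exact: integrable_fin_num.
Unshelve. all: by end_near. Qed.

Lemma bounded_cvg_Rintegral_at_right (D : set R) (f_ : R -> R -> R) (f : R -> R) (M : R) :
  measurable D -> (mu D < +oo)%E ->
  (forall n, measurable_fun D (f_ n)) -> measurable_fun D f ->
  (\forall n \near 0^'+, forall s, D s -> `|f_ n s| <= M) ->
  (forall s, D s -> f_ n s @[n --> 0^'+] --> f s) ->
  (\int[mu]_(s in D) f_ n s)%R @[n --> 0^'+] --> (\int[mu]_(s in D) f s)%R.
Proof.
move=> mD fD mf_ mf HM ff; apply/cvg_at_rightP => u [u0 ucvg].
apply: (@bounded_cvg_Rintegral D (fun n => f_ (u n)) f M) => //.
- case: HM => e /= e0 He; near=> n; apply: He; last exact: u0.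
  by near: n; exact: (cvgr_dist_lt _ _ ucvg).
- by move=> s /ff /cvg_at_rightP; exact.
Unshelve. all: by end_near. Qed.

End dominated.

(** * Karamata's theorem for a density at 0 *)

Lemma near_at_right0P (R : realType) (P : set R) :
  (\forall t \near 0^'+, P t) <->
  exists2 d : R, 0 < d & forall t, 0 < t -> t < d -> P t.
Proof.
split.
- case=> e /= e0 He; exists e => // t t0 te; apply: He => //=.
  by rewrite sub0r normrN gtr0_norm.
- case=> d d0 Hd; exists d => // t /=; rewrite sub0r normrN => td t0.
  by apply: Hd => //; rewrite (le_lt_trans _ td)// ler_norm.
Qed.

Lemma cvg_min_cst (R : realType) (T : Type) (F : set_system T) {FF : Filter F}
    (f : T -> R) (l c : R) :
  f x @[x --> F] --> l -> Num.min (f x) c @[x --> F] --> Num.min l c.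
Proof.
move=> fl; apply/cvgrPdist_le => e e0; near=> x.
have : `|l - f x| <= e by near: x; exact: (cvgr_dist_le _ _ fl).
apply: le_trans; have := ler_norm (l - f x); have := ler_norm (f x - l).
rewrite distrC ler_norml.
by case: (ltP l c) => ?; case: (ltP (f x) c) => ? ? ?; apply/andP; split; lra.
Unshelve. all: by end_near. Qed.

Section karamata.
Context {R : realType} (k V : R -> R) (b r0 : R).
Local Notation mu := (@lebesgue_measure R).
Context (mk : measurable_fun [set: R] k) (k_ge0 : forall x, 0 <= k x).
Context (b_gt0 : 0 < b) (r0_gt0 : 0 < r0).
Context (k_gt0 : forall x, 0 < x -> x < r0 -> 0 < k x).
Context (V_gt0 : forall x, 0 < x -> 0 < V x).
Context (V_int : forall x, 0 < x ->
  (V x)%:E = (\int[mu]_(s in `]0%R, x]) (k s)%:E)%E).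
Context (k_rv : forall s, 0 < s -> k (t * s) / k t @[t --> 0^'+] --> s `^ (b - 1)).

Let mkE : measurable_fun [set: R] (EFin \o k).
Proof. exact/measurable_EFinP. Qed.

Let mkc (c : R) : measurable_fun [set: R] (fun s => k (c * s)).
Proof. by apply: measurableT_comp => //; exact: mulrl_measurable. Qed.

Lemma integral_scaled_density (c x : R) : 0 < c -> 0 < x ->
  ((V (c * x))%:E = c%:E * \int[mu]_(s in `]0%R, x]) (k (c * s))%:E)%E.
Proof.
move=> c0 x0; rewrite V_int ?mulr_gt0//.
rewrite (@ge0_integral_scale _ c)//.
congr (_ * _)%E; congr (integral _ _ _).
apply/seteqP; split=> s /=; rewrite !in_itv/=.
  by rewrite pmulr_rgt0// ler_pM2l.
by rewrite pmulr_rgt0// ler_pM2l.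
Qed.

(** Integrating [k (c s) ~ c^(b-1) k s] over ]0, x]. *)
Lemma distribution_regularly_varying (c : R) : 0 < c ->
  V (c * x) / V x @[x --> 0^'+] --> c `^ b.
Proof.
move=> c0; apply/cvgrPdist_le => e e0.
have ec0 : 0 < e / c by rewrite divr_gt0.
have /near_at_right0P[d d0 Hd] : \forall t \near 0^'+,
    `|c `^ (b - 1) - k (t * c) / k t| <= e / c.
  by apply: (cvgr_dist_le _ _ (k_rv c0)).
apply/near_at_right0P; exists (Num.min d r0); first by rewrite lt_min d0.
move=> x x0; rewrite lt_min => /andP[xd xr].
have Vx := V_gt0 x0.
set L := c `^ (b - 1) in Hd.
have L0 : 0 <= L by rewrite powR_ge0.
have Hk s : `]0, x]%classic s -> L * k s <= k (c * s) + e / c * k s /\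
    k (c * s) <= (L + e / c) * k s.
  rewrite /= in_itv/= => /andP[s0 sx].
  have ks : 0 < k s by apply: k_gt0 => //; exact: le_lt_trans xr.
  have := Hd s s0 (le_lt_trans sx xd); rewrite [s * c]mulrC.
  have -> : k (c * s) = k (c * s) / k s * k s by rewrite divfK// gt_eqF.
  rewrite mulfK ?gt_eqF// -mulrDl ler_norml => /andP[h1 h2].
  by split; apply: ler_wpM2r => //; lra.
have mD : measurable (`]0, x]%classic : set R) by exact: measurable_itv.
have mkD (c' : R) : measurable_fun (`]0, x]%classic : set R) (fun s => (k (c' * s))%:E).
  by apply: measurable_funTS; apply/measurable_EFinP; exact: mkc.
have mkD1 : measurable_fun (`]0, x]%classic : set R) (EFin \o k) by exact: measurable_funTS.
have VJ := integral_scaled_density c0 x0.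
have VI := V_int x0.
set J := integral _ _ _ in VJ; set I := integral _ _ _ in VI.
have HJ : exists j : R, J = j%:E.
  exists (V (c * x) / c); rewrite mulrC EFinM VJ muleA -EFinM mulVf ?gt_eqF//.
  by rewrite mul1e.
case: HJ => j Jj; rewrite Jj -EFinM in VJ; case: VJ => VJ.
have h1 : j <= (L + e / c) * V x.
  rewrite -lee_fin -Jj EFinM VI -ge0_integralZl_EFin//; last first.
  - by rewrite addr_ge0// ltW.
  - by move=> s _; rewrite lee_fin.
  apply: ge0_le_integral => //.
  - by move=> s _; rewrite lee_fin.
  - exact: mkD.
  - by apply: measurable_funeM.
  - by move=> s /Hk[_]; rewrite -EFinM lee_fin.
have h2 : L * V x <= j + e / c * V x.
  rewrite -lee_fin EFinD -Jj !EFinM VI.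
  have VIc (c' : R) : 0 <= c' -> (c'%:E * I = \int[mu]_(s in `]0%R, x]) (c'%:E * (k s)%:E))%E.
    move=> c'0; rewrite ge0_integralZl_EFin// => s _.
    by rewrite lee_fin.
  rewrite !VIc//; last exact: ltW.
  rewrite -ge0_integralD//; last 4 first.
  - by move=> s _; rewrite lee_fin.
  - exact: mkD.
  - by move=> s _; rewrite -EFinM lee_fin mulr_ge0// ltW.
  - by apply: measurable_funeM.
  apply: ge0_le_integral => //.
  - by move=> s _; rewrite -EFinM lee_fin mulr_ge0.
  - by apply: measurable_funeM.
  - by apply: emeasurable_funD; [exact: mkD|apply: measurable_funeM].
  - by move=> s /Hk[+ _]; rewrite -!EFinM -EFinD lee_fin.
have -> : c `^ b = c * L.
  rewrite -[in LHS](subrK 1 b) powRD; last by rewrite (gt_eqF c0) implybT.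
  by rewrite powRr1 1?ltW// mulrC.
have cec : c * (e / c) = e by rewrite mulrC divfK// gt_eqF.
have H1 : c * j / V x <= c * L + e.
  rewrite ler_pdivrMr//; have := ler_wpM2l (ltW c0) h1.
  by rewrite mulrA mulrDr cec.
have H2 : c * L - e <= c * j / V x.
  rewrite ler_pdivlMr//; have := ler_wpM2l (ltW c0) h2.
  by rewrite mulrDr 2!mulrA cec mulrBl lerBlDr.
by rewrite VJ ler_norml; apply/andP; split; lra.
Qed.


Let D : set R := `]1, 2]%classic.
Let mD : measurable D. Proof. exact: measurable_itv. Qed.
Let mD' : measurable (D : set (measurableTypeR R)). Proof. exact: mD. Qed.
Let finD : (mu D < +oo)%E.
Proof. by rewrite lebesgue_measure_itv/= lte_fin ltr1n -EFinD ltry. Qed.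

Let integral_octave (x : R) : 0 < x ->
  mu.-integrable D (EFin \o (fun s => k (x * s))) /\
  V (2 * x) - V x = x * (\int[mu]_(s in D) k (x * s))%R.
Proof.
move=> x0; have x20 : 0 < 2 * x by rewrite mulr_gt0.
have H : (V (2 * x))%:E = ((V x)%:E + x%:E * \int[mu]_(s in D) (k (x * s))%:E)%E.
  rewrite !V_int//.
  rewrite (@itv_bndbnd_setU _ _ _ (BRight x)) ?bnd_simp ?ltW//; last first.
    by rewrite ltr_pMl// ltr1n.
  rewrite ge0_integral_setU//; last 3 first.
  - exact: measurable_funTS.
  - by move=> s _; rewrite lee_fin.
  - apply/disj_setPS => s [] /=; rewrite !in_itv/= => /andP[_ sx] /andP[xs _].
    by move: (lt_le_trans xs sx); rewrite ltxx.
  congr (_ + _)%E; rewrite [LHS](ge0_integral_scale x0)//.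
  congr (_ * _)%E; congr (integral _ _ _).
  apply/seteqP; split=> s /=; rewrite !in_itv/= mulrC ltr_pMl// [s * x]mulrC.
    by rewrite [2 * x]mulrC ler_pM2l.
  by rewrite [2 * x]mulrC ler_pM2l.
have If : (\int[mu]_(s in D) (k (x * s))%:E =
    ((V (2 * x) - V x) / x)%:E)%E.
  rewrite mulrC EFinM EFinB H [X in (X - _)%E]addeC addeK// muleA -EFinM mulVf ?gt_eqF//.
  by rewrite mul1e.
split.
  apply/integrableP; split.
    by apply: measurable_funTS; apply/measurable_EFinP; exact: mkc.
  under eq_integral do rewrite /= ger0_norm//.
  by rewrite If ltry.
by rewrite /Rintegral If /= [RHS]mulrC divfK// gt_eqF.
Qed.

Let eta x := x * k x / V x.

Let mratio (x : R) : measurable_fun D (fun s => k (x * s) / k x).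
Proof. by apply: measurable_funTS; apply: measurable_funM => //; exact: mkc. Qed.

Let ratio_cvg (s : R) : D s -> k (x * s) / k x @[x --> 0^'+] --> s `^ (b - 1).
Proof. by rewrite /D/= in_itv/= => /andP[s1 _]; apply: k_rv; exact: lt_trans s1. Qed.

(** Bounded convergence applied to the truncated ratio min(k(xs)/k(x), 1) bounds
the mass of an octave from below by a multiple of x k(x). *)
Let eta_bounded : \forall x \near 0^'+, eta x <= 4 * 2 `^ b.
Proof.
pose m := fun s : R => Num.min (s `^ (b - 1)) 1.
have Hm : (\int[mu]_(s in D) Num.min (k (x * s) / k x) 1)%R @[x --> 0^'+]
   --> (\int[mu]_(s in D) m s)%R.
  apply: (@bounded_cvg_Rintegral_at_right _ D
    (fun x s => Num.min (k (x * s) / k x) 1) m 1) => //.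
  - by move=> x; apply: measurable_minr.
  - by apply: measurable_minr => //; exact: measurable_powRl.
  - near=> x => s _.
    rewrite ger0_norm ?ge_min ?lexx ?orbT// le_min ler01 andbT.
    by rewrite divr_ge0.
  - move=> s Ds; apply: cvg_min_cst.
    exact: ratio_cvg.
have m12 : 1 / 2 <= (\int[mu]_(s in D) m s)%R.
  have -> : 1 / 2 = (\int[mu]_(s in D) (cst (1 / 2) s))%R :> R.
    rewrite Rintegral_cst// /D/= lebesgue_measure_itv/= lte_fin ltr1n/=.
    by lra.
  apply: le_Rintegral => //.
  - by apply: (@bounded_measurable_integrable _ _ _ `|1 / 2|).
  - apply: (@bounded_measurable_integrable _ _ _ 1) => //.
      by apply: measurable_minr => //; exact: measurable_powRl.
    move=> s _; rewrite ger0_norm ?ge_min ?lexx ?orbT// le_min ler01 andbT.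
    exact: powR_ge0.
  - move=> s; rewrite /D/= in_itv/= => /andP[s1 s2].
    rewrite le_min; apply/andP; split; last by lra.
    have s0 : 0 < s by exact: lt_trans s1.
    rewrite powRD; last by rewrite (gt_eqF s0) implybT.
    rewrite powR_inv1; last exact: ltW.
    have : 1 <= s `^ b by rewrite -(powRr0 s) ler_powR ?ltW.
    rewrite ler_pdivlMr// => sb; apply: le_trans sb.
    by lra.
have V2 := distribution_regularly_varying (ltr0Sn R 1).
near=> x.
have x0 : 0 < x by [].
have xr : x < r0 by near: x; exact: nbhs_right_lt.
have Vx := V_gt0 x0; have kx := k_gt0 x0 xr.
have [ki Vk] := integral_octave x0.
have H1 : 1 / 4 <= (\int[mu]_(s in D) Num.min (k (x * s) / k x) 1)%R.
  by near: x; apply: (cvgr_ge _ Hm); apply: lt_le_trans m12; lra.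
have H2 : V (2 * x) / V x <= 2 `^ b + 1.
  by near: x; apply: (cvgr_le _ V2); rewrite ltrDl.
have H3 : k x * (\int[mu]_(s in D) Num.min (k (x * s) / k x) 1)%R
    <= (\int[mu]_(s in D) k (x * s))%R.
  rewrite -RintegralZl//; last first.
    apply: (@bounded_measurable_integrable _ _ _ 1) => //.
      by apply: measurable_minr.
    move=> s _; rewrite ger0_norm ?ge_min ?lexx ?orbT// le_min ler01 andbT.
    by rewrite divr_ge0.
  apply: le_Rintegral => //.
    apply: (@bounded_measurable_integrable _ _ _ (k x)) => //.
      by apply: measurable_funM => //; apply: measurable_minr.
    move=> s _; rewrite ger0_norm; last first.
      by rewrite mulr_ge0 ?(ltW kx)// le_min ler01 andbT divr_ge0.
    by rewrite -[leRHS]mulr1 ler_pM2l// ge_min lexx orbT.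
  move=> s _; apply: (@le_trans _ _ (k x * (k (x * s) / k x))).
    by rewrite ler_pM2l// ge_min lexx.
  by rewrite mulrC divfK// gt_eqF.
move: H2; rewrite ler_pdivrMr// => H2.
rewrite /eta ler_pdivrMr//.
have H4 : k x * (1 / 4) <= (\int[mu]_(s in D) k (x * s))%R.
  by apply: le_trans H3; rewrite ler_pM2l.
have : x * (k x * (1 / 4)) <= V (2 * x) - V x by rewrite Vk ler_pM2l.
by move=> h; nra.
Unshelve. all: by end_near. Qed.

(** Karamata's theorem.  On the octave ]1, 2] the functions [k (x s)], scaled by
[x / V x], differ from [eta x * s^(b-1)] by a bounded quantity tending to 0,
while their integrals are known from the regular variation of [V]. *)
Lemma karamata : x * k x / V x @[x --> 0^'+] --> b.
Proof.
have V2 := distribution_regularly_varying (ltr0Sn R 1).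
pose M := 4 * 2 `^ b.
have M0 : 0 < M by rewrite mulr_gt0// powR_gt0.
have b1 s : D s -> s `^ (b - 1) <= 2 `^ b.
  rewrite /D/= in_itv/= => /andP[s1 s2].
  have s0 : 0 < s by exact: lt_trans s1.
  apply: (@le_trans _ _ (s `^ b)).
    by rewrite ler_powR ?ltW// ltrBlDr ltrDl.
  by rewrite ge0_ler_powR// ?nnegrE ltW.
have eta0 x : 0 < x -> 0 <= eta x.
  by move=> x0; rewrite /eta divr_ge0 ?mulr_ge0 ?(ltW x0) ?(ltW (V_gt0 x0)).
have [d d0 Hd] : exists2 d, 0 < d & forall x, 0 < x -> x < d -> eta x <= M.
  by apply/near_at_right0P; exact: eta_bounded.
pose g := fun x s => x / V x * k (x * s) - eta x * s `^ (b - 1).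
have Hg : (\int[mu]_(s in D) g x s)%R @[x --> 0^'+] --> (\int[mu]_(s in D) 0)%R.
  apply: (@bounded_cvg_Rintegral_at_right _ D g (cst 0)
      (M * (2 `^ b + 1) + M * 2 `^ b)) => //.
  - move=> x; apply: measurable_funB; apply: measurable_funM => //.
      exact: measurable_funTS.
    exact: measurable_powRl.
  - near=> x => s Ds.
    have x0 : 0 < x by [].
    have xd : x < d / 2 by near: x; apply: nbhs_right_lt; rewrite divr_gt0.
    have Vx := V_gt0 x0.
    have [s1 s2] : 1 < s /\ s <= 2.
      by move: Ds; rewrite /D/= in_itv/= => /andP[].
    have s0 : 0 < s by exact: lt_trans s1.
    have sx0 : 0 < x * s by rewrite mulr_gt0.
    apply: (le_trans (ler_normB _ _)); apply: lerD; last first.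
      rewrite ger0_norm; last by apply: mulr_ge0; [exact: eta0|exact: powR_ge0].
      apply: ler_pM; [exact: eta0|exact: powR_ge0| |exact: b1].
      by apply: Hd => //; lra.
        rewrite ger0_norm; last by rewrite mulr_ge0// divr_ge0 ?(ltW x0) ?(ltW Vx).
    have V2x : V (2 * x) / V x <= 2 `^ b + 1.
      by near: x; apply: (cvgr_le _ V2); rewrite ltrDl.
    have Vsx := V_gt0 sx0.
    have -> : x / V x * k (x * s) = eta (x * s) * ((V (x * s) / V x) / s).
      by rewrite /eta; field; rewrite !gt_eqF.
    apply: ler_pM.
    + exact: eta0.
    + by rewrite !divr_ge0 ?(ltW Vsx) ?(ltW Vx) ?(ltW s0).
    + by apply: Hd => //; nra.
    + rewrite ler_pdivrMr//; apply: (@le_trans _ _ (2 `^ b + 1)).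
        apply: le_trans V2x; rewrite ler_pM2r ?invr_gt0//.
        have Vmono y z : 0 < y -> y <= z -> V y <= V z.
          move=> y0 yz; rewrite -lee_fin !V_int//; last exact: lt_le_trans yz.
          apply: ge0_subset_integral => //.
          - exact: measurable_funTS.
          - by move=> t _; rewrite lee_fin.
          - by apply: subset_itvl; rewrite bnd_simp.
        by apply: Vmono => //; rewrite mulrC ler_pM2r.
      by rewrite ler_pMr ?ltW// ltr_wpDl// powR_ge0.
  - move=> s Ds; apply/cvgrPdist_le => e e0.
    near=> x; rewrite sub0r normrN.
    have x0 : 0 < x by [].
    have xr : x < r0 by near: x; exact: nbhs_right_lt.
    have Vx := V_gt0 x0; have kx := k_gt0 x0 xr.
    have -> : g x s = eta x * - (s `^ (b - 1) - k (x * s) / k x).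
      by rewrite /g /eta; field; rewrite !gt_eqF.
    rewrite normrM normrN ger0_norm ?eta0//.
    apply: (@le_trans _ _ (M * (e / M))); last by rewrite mulrC divfK// gt_eqF.
    apply: ler_pM; rewrite ?eta0//.
      by apply: Hd => //; near: x; exact: nbhs_right_lt.
    by near: x; apply: (cvgr_dist_le _ _ (ratio_cvg Ds)); rewrite divr_gt0.
rewrite Rintegral_cst// mul0r in Hg.
have I1 : mu.-integrable D (EFin \o (fun s => s `^ (b - 1))).
  apply: (@bounded_measurable_integrable _ _ _ (2 `^ b)) => //.
    exact: measurable_powRl.
  by move=> s Ds; rewrite ger0_norm ?powR_ge0//; exact: b1.
have I2 : (\int[mu]_(s in D) s `^ (b - 1))%R = (2 `^ b - 1) / b.
  apply: (@mulfI _ b); first by rewrite gt_eqF.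
  rewrite -RintegralZl// /Rintegral integral_powR_pos ?ltr1n//= powR1.
  by rewrite mulrC divfK// gt_eqF.
have Ig : \forall x \near 0^'+, (\int[mu]_(s in D) g x s)%R =
    V (2 * x) / V x - 1 - eta x * ((2 `^ b - 1) / b).
  near=> x; have x0 : 0 < x by [].
  have [ki Vk] := integral_octave x0; have Vx := V_gt0 x0.
  have J1 : mu.-integrable D (EFin \o (fun s => x / V x * k (x * s))).
    by apply: eq_integrable (integrableZl mD' (x / V x) ki) => // s _; rewrite /= EFinM.
  have J2 : mu.-integrable D (EFin \o (fun s => eta x * s `^ (b - 1))).
    by apply: eq_integrable (integrableZl mD' (eta x) I1) => // s _; rewrite /= EFinM.
  rewrite (RintegralB mD' J1 J2).
  rewrite !RintegralZl// I2; congr (_ - _).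
  rewrite mulrAC -Vk mulrBl divff ?gt_eqF//.
have b20 : 0 < 2 `^ b - 1 :> R.
  have := @gt0_ltr_powR R b b_gt0 1 2.
  by rewrite powR1 subr_gt0 !nnegrE ltr1n; apply.
have H : b / (2 `^ b - 1) * (V (2 * x) / V x - 1 - (\int[mu]_(s in D) g x s)%R)
    @[x --> 0^'+] --> b / (2 `^ b - 1) * (2 `^ b - 1 - 0).
  apply: cvgM; first exact: cvg_cst.
  apply: cvgB; last exact: Hg.
  by apply: cvgB; [exact: V2|exact: cvg_cst].
rewrite subr0 divfK ?gt_eqF// in H.
apply: near_eq_cvg_to H; near=> x.
have -> : (\int[mu]_(s in D) g x s)%R = V (2 * x) / V x - 1 - eta x * ((2 `^ b - 1) / b).
  by near: x.
by rewrite /eta; field; rewrite !gt_eqF ?V_gt0.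
Unshelve. all: by end_near. Qed.

End karamata.

(** * The incomplete Gamma function *)

Section incomplete_gamma.
Context {R : realType}.
Local Notation mu := (@lebesgue_measure R).

Lemma integral_powR (p x y : R) : 0 < p -> 0 <= x -> x <= y ->
  (\int[mu]_(v in `]x, y]) (p * v `^ (p - 1))%:E = (y `^ p - x `^ p)%:E)%E.
Proof.
move=> p0; rewrite le_eqVlt => /predU1P[<- y0|x0].
  by rewrite integral_powR0// powR0 ?gt_eqF// subr0.
rewrite le_eqVlt => /predU1P[<-|xy]; last exact: integral_powR_pos.
by rewrite subrr set_itvoc0 integral_set0.
Qed.

Let f (b v : R) : R := v `^ (b - 1) * expR (- v).

Let mf (b : R) (D : set R) : measurable_fun D (f b).
Proof.
apply: measurable_funM; first exact: measurable_powRl.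
by apply: measurable_funTS; apply: measurableT_comp.
Qed.

Let f_ge0 b v : 0 <= f b v.
Proof. by rewrite mulr_ge0 ?powR_ge0 ?expR_ge0. Qed.

Definition lower_gamma (b x : R) : R := fine (\int[mu]_(v in `]0%R, x]) (f b v)%:E)%E.

Lemma integral_gamma_bounds (b x y : R) : 0 < b -> 0 <= x -> x <= y ->
  (((y `^ b - x `^ b) * expR (- y))%:E <= b%:E * \int[mu]_(v in `]x, y]) (f b v)%:E /\
   b%:E * \int[mu]_(v in `]x, y]) (f b v)%:E <= ((y `^ b - x `^ b) * expR (- x))%:E)%E.
Proof.
move=> b0 x0 xy.
have mD : measurable (`]x, y]%classic : set R) by exact: measurable_itv.
have mb (c : R) : measurable_fun (`]x, y]%classic : set R)
    (fun v => (c%:E * (b * v `^ (b - 1))%:E)%E).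
  apply: measurable_funeM; apply/measurable_EFinP; apply: measurable_funM => //.
  exact: measurable_powRl.
have b_ge0 v : (0 <= (b * v `^ (b - 1))%:E)%E.
  by rewrite lee_fin mulr_ge0 ?powR_ge0 ?(ltW b0).
have E (c : R) : 0 <= c -> (((y `^ b - x `^ b) * c)%:E =
    \int[mu]_(v in `]x, y]) (c%:E * (b * v `^ (b - 1))%:E))%E.
  move=> c0; rewrite mulrC EFinM -integral_powR// ge0_integralZl_EFin//.
  apply/measurable_EFinP; apply: measurable_funM => //; exact: measurable_powRl.
rewrite !E ?expR_ge0// -ge0_integralZl_EFin//; last 3 first.
- by move=> v _; rewrite lee_fin.
- by apply/measurable_EFinP; exact: mf.
- exact: ltW.
have mbf : measurable_fun (`]x, y]%classic : set R) (fun v => (b%:E * (f b v)%:E)%E).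
  by apply: measurable_funeM; apply/measurable_EFinP; exact: mf.
split; apply: ge0_le_integral => //; try exact: mb.
- by move=> v _; apply: mule_ge0; [rewrite lee_fin expR_ge0|exact: b_ge0].
- move=> v; rewrite /= in_itv/= => /andP[xv vy].
  rewrite -!EFinM lee_fin mulrCA; apply: ler_wpM2l; first exact: ltW.
  by rewrite mulrC; apply: ler_wpM2l; rewrite ?powR_ge0// ler_expR lerN2.
- by move=> v _; apply: mule_ge0; rewrite lee_fin ?f_ge0 ?(ltW b0).
- move=> v; rewrite /= in_itv/= => /andP[xv vy].
  rewrite -!EFinM lee_fin [leRHS]mulrCA; apply: ler_wpM2l; first exact: ltW.
  by rewrite [leRHS]mulrC; apply: ler_wpM2l; rewrite ?powR_ge0// ler_expR lerN2 ltW.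
Qed.

Let lower_gamma_fin (b x y : R) : 0 < b -> 0 <= x -> x <= y ->
  exists i : R, (\int[mu]_(v in `]x, y]) (f b v)%:E = i%:E)%E.
Proof.
move=> b0 x0 xy; have [_] := integral_gamma_bounds b0 x0 xy.
have : (0 <= \int[mu]_(v in `]x, y]) (f b v)%:E)%E.
  by apply: integral_ge0 => v _; rewrite lee_fin.
case: integral => [i _ _|_|//]; first by exists i.
by rewrite mulry gtr0_sg// mul1e.
Qed.

Lemma lower_gammaE (b x : R) : 0 < b -> 0 <= x ->
  ((lower_gamma b x)%:E = \int[mu]_(v in `]0%R, x]) (f b v)%:E)%E.
Proof.
by move=> b0 x0; have [i] := lower_gamma_fin b0 (lexx 0) x0; rewrite /lower_gamma => ->.
Qed.

Lemma lower_gamma0 (b : R) : lower_gamma b 0 = 0.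
Proof. by rewrite /lower_gamma set_itvoc0 integral_set0. Qed.

(** [exp] is monotone on [x, y] and [b v^(b-1)] integrates to the increment of
[v^b]: increments of the incomplete Gamma function are pinched as in a
Stieltjes sum. *)
Lemma lower_gamma_increment (b x y : R) : 0 < b -> 0 <= x -> x <= y ->
  (y `^ b - x `^ b) * expR (- y) <= b * (lower_gamma b y - lower_gamma b x) /\
  b * (lower_gamma b y - lower_gamma b x) <= (y `^ b - x `^ b) * expR (- x).
Proof.
move=> b0 x0 xy; have y0 := le_trans x0 xy.
have [i Ei] := lower_gamma_fin b0 x0 xy.
have -> : lower_gamma b y - lower_gamma b x = i.
  suff -> : lower_gamma b y = lower_gamma b x + i by rewrite addrC addKr.
  apply: EFin_inj; rewrite EFinD !lower_gammaE// -Ei.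
  rewrite (@itv_bndbnd_setU _ _ _ (BRight x)) ?bnd_simp//.
  rewrite ge0_integral_setU//; first by apply/measurable_EFinP; exact: mf.
  - by move=> v _; rewrite lee_fin.
  - apply/disj_setPS => v [] /=; rewrite !in_itv/= => /andP[_ sx] /andP[xs _].
    by move: (lt_le_trans xs sx); rewrite ltxx.
have [] := integral_gamma_bounds b0 x0 xy.
by rewrite Ei -EFinM !lee_fin.
Qed.

Lemma lower_gamma_le (b x y : R) : 0 < b -> 0 <= x -> x <= y ->
  lower_gamma b x <= lower_gamma b y.
Proof.
move=> b0 x0 xy; have [+ _] := lower_gamma_increment b0 x0 xy.
move=> h; rewrite -subr_ge0 -(pmulr_rge0 _ b0); apply: le_trans h.
rewrite mulr_ge0 ?expR_ge0// subr_ge0.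
by apply: ge0_ler_powR; rewrite ?nnegrE ?(ltW b0)// (le_trans x0).
Qed.

Lemma lower_gamma_gt0 (b x : R) : 0 < b -> 0 < x -> 0 < lower_gamma b x.
Proof.
move=> b0 x0; have [+ _] := lower_gamma_increment b0 (lexx 0) (ltW x0).
rewrite lower_gamma0 subr0 powR0 ?gt_eqF// subr0 => h.
rewrite -(pmulr_rgt0 _ b0); apply: lt_le_trans h.
by rewrite mulr_gt0 ?expR_gt0 ?powR_gt0.
Qed.

(** Monotone convergence; the bound M makes the improper integral finite. *)
Lemma lower_gamma_cvg (b M : R) : 0 < b ->
  (forall x, 0 <= x -> lower_gamma b x <= M) ->
  lower_gamma b x @[x --> +oo] --> Gamma_fun b.
Proof.
move=> b0 HM.
have H : (\int[mu]_(v in `]0%R, n%:R]) (f b v)%:E)%E @[n --> \oo] -->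
    (\int[mu]_(v in \bigcup_n `]0%R, n%:R]%classic) (f b v)%:E)%E.
  apply: ge0_nondecreasing_set_cvg_integral.
  - move=> m n mn; rewrite subsetEset; apply: subset_itvl; rewrite bnd_simp.
    by rewrite ler_nat.
  - by move=> n; exact: measurable_itv.
  - by move=> n; apply/measurable_EFinP; exact: mf.
  - by move=> n v _; rewrite lee_fin.
have U : \bigcup_n `]0%R, n%:R]%classic = (`]0%R, +oo[%classic : set R).
  apply/seteqP; split=> v.
    by move=> [n _] /=; rewrite !in_itv/= andbT => /andP[].
  rewrite /= in_itv/= andbT => v0; exists (Num.bound v) => //=.
  by rewrite in_itv/= v0/= ltW// archi_boundP// ltW.
rewrite U in H.
have {}H : (lower_gamma b n%:R)%:E @[n --> \oo] -->
    (\int[mu]_(v in `]0%R, +oo[) (f b v)%:E)%E.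
  by apply: cvg_trans H; apply: near_eq_cvg; apply: nearW => n; rewrite lower_gammaE.
have G : (\int[mu]_(v in `]0%R, +oo[) (f b v)%:E)%E = (Gamma_fun b)%:E.
  rewrite /Gamma_fun /Rintegral fineK// ge0_fin_numE; last first.
    by apply: integral_ge0 => v _; rewrite lee_fin; exact: f_ge0.
  apply: (@le_lt_trans _ _ M%:E); last exact: ltry.
  apply: (cvge_le _ H); apply: nearW => n; rewrite lee_fin.
  exact: HM.
rewrite G in H.
have /fine_cvg {}H := H.
have le n : lower_gamma b n%:R <= Gamma_fun b.
  apply: (cvgr_to_ge H); near=> m; rewrite /=.
  apply: lower_gamma_le => //; rewrite ler_nat; near: m; exact: nbhs_infty_ge.
apply/cvgrPdist_le => e e0.
have /cvgrPdist_le/(_ e e0)[N _ HN] := H.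
near=> x.
have Nx : N%:R <= x by near: x; apply: nbhs_pinfty_ge; exact: num_real.
have x0 : 0 <= x by apply: le_trans Nx.
have := HN N (leqnn N); rewrite /=.
have h1 := lower_gamma_le b0 (ler0n R N) Nx.
have h2 : lower_gamma b x <= Gamma_fun b.
  apply: (le_trans (lower_gamma_le b0 x0 (ltW (archi_boundP x0)))); exact: le.
rewrite ger0_norm ?subr_ge0// => h3.
by rewrite ger0_norm ?subr_ge0//; lra.
Unshelve. all: by end_near. Qed.

End incomplete_gamma.

Section angular_profile.
Context {R : realType}.

(** The angular scale t^(-1/2) at level u. *)
Definition angle_scale (w : R -> R) (u : R) : R := Num.sqrt (1 / (u * w u)).

(** The integral of e^(-v^2/2) d(v^(2b)) over [0, x], written with the variable v^2/2. *)
Definition angular_profile (b x : R) : R := 2 `^ b * b * lower_gamma b (x ^+ 2 / 2).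

Definition total_profile (b : R) : R := 2 `^ b * b * Gamma_fun b.

(** Up to the factor 2 [total_profile b], the distribution function of the symmetric
law whose square is Gamma distributed with parameters b and 1/2. *)
Definition half_plane_profile (b s : R) : R := total_profile b +
  (if 0 <= s then angular_profile b s else - angular_profile b (- s)).

Context (b : R) (b_gt0 : 0 < b).
Local Notation I := (angular_profile b).

Lemma powR_double (x : R) : 0 <= x -> x `^ (2 * b) = 2 `^ b * (x ^+ 2 / 2) `^ b.
Proof.
move=> x0; rewrite -powRM ?divr_ge0 ?sqr_ge0//.
by rewrite [2 * (_ / _)]mulrC divfK ?pnatr_eq0// powRrM powR_mulrn.
Qed.

Lemma angular_profile_increment (x y : R) : 0 <= x -> x <= y ->
  (y `^ (2 * b) - x `^ (2 * b)) * expR (- (y ^+ 2 / 2)) <= I y - I x /\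
  I y - I x <= (y `^ (2 * b) - x `^ (2 * b)) * expR (- (x ^+ 2 / 2)).
Proof.
move=> x0 xy; have y0 := le_trans x0 xy.
have xy2 : x ^+ 2 / 2 <= y ^+ 2 / 2 by rewrite ler_pM2r// ler_sqr ?nnegrE.
have [h1 h2] := lower_gamma_increment b_gt0 (divr_ge0 (sqr_ge0 x) (ler0n R 2)) xy2.
have c0 : 0 <= 2 `^ b :> R by rewrite powR_ge0.
rewrite !powR_double// /angular_profile.
move: (x ^+ 2 / 2) (y ^+ 2 / 2) h1 h2 => x' y' h1 h2; rewrite -!mulrBr -!mulrA.
by split; apply: ler_wpM2l.
Qed.

End angular_profile.

(** * Limits of Stieltjes type *)

Section stieltjes.
Context {R : realType} {T : Type} (F : set_system T) {FF : Filter F}.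

(** The masses [p u] of the intervals ]s1, s2] are asymptotically between
[(m s2 - m s1) g s2] and [(m s2 - m s1) g s1], and so are the increments of [J].
Summing over a uniform grid identifies the limit of [p u], because [g] has small
oscillation on the cells. *)
Lemma stieltjes_limit (p : T -> R -> R) (m g J : R -> R) (s C : R) :
  0 <= s -> 0 <= C -> (forall u, p u 0 = 0) -> J 0 = 0 -> 0 <= m 0 ->
  (forall x y, 0 <= x -> x <= y -> m x <= m y) ->
  (forall x y, 0 <= x -> x <= y -> y <= s -> g x - g y <= C * (y - x)) ->
  (forall x y, 0 <= x -> x <= y -> y <= s ->
     (m y - m x) * g y <= J y - J x /\ J y - J x <= (m y - m x) * g x) ->
  (forall x y e, 0 <= x -> x <= y -> y <= s -> 0 < e -> \forall u \near F,
     (m y - m x) * g y - e <= p u y - p u x /\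
     p u y - p u x <= (m y - m x) * g x + e) ->
  p u s @[u --> F] --> J s.
Proof.
move=> s0 C0 p0 J0 m0 m_nd gC HJ Hp; apply/cvgrPdist_le => e e0.
have ms0 : 0 <= m s by apply: le_trans (m_nd 0 s _ _).
have [N HN] : exists N : nat, C * s * m s <= N.+1%:R * (e / 2).
  exists (Num.bound (C * s * m s / (e / 2))).
  rewrite -ler_pdivrMr ?divr_gt0//.
  have h : 0 <= C * s * m s / (e / 2) by rewrite divr_ge0 ?mulr_ge0// ltW.
  by apply: (le_trans (ltW (archi_boundP h))); rewrite ler_nat.
have N0 : 0 < N.+1%:R :> R by rewrite ltr0n.
pose h := s / N.+1%:R; have h0 : 0 <= h by rewrite divr_ge0// ltW.
pose eps := C * h.
have hs k : (k <= N.+1)%N -> k%:R * h <= s.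
  move=> kN; rewrite /h mulrA ler_pdivrMr// mulrC ler_wpM2l// ler_nat//.
have step k : k%:R * h <= k.+1%:R * h by rewrite ler_wpM2r// ler_nat.
have H k : (k <= N.+1)%N -> forall eta, 0 < eta -> \forall u \near F,
    `|J (k%:R * h) - p u (k%:R * h)| <= m (k%:R * h) * eps + eta.
  elim: k => [_ eta eta0|k IH kN eta eta0].
    near=> u; rewrite mul0r J0 p0 subrr normr0.
    by rewrite addr_ge0 ?(ltW eta0)// mulr_ge0// /eps mulr_ge0.
  have eta2 : 0 < eta / 2 by rewrite divr_gt0.
  have kh0 : 0 <= k%:R * h by rewrite mulr_ge0// ltW.
  (* on the k-th cell both p u and J lie between two products differing by at most
     eps times the increment of m *)
  have [hJ1 hJ2] := HJ _ _ kh0 (step k) (hs _ kN).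
  have hg := gC _ _ kh0 (step k) (hs _ kN).
  have hm := m_nd _ _ kh0 (step k).
  have hg' : (m (k.+1%:R * h) - m (k%:R * h)) * g (k%:R * h)
      <= (m (k.+1%:R * h) - m (k%:R * h)) * g (k.+1%:R * h)
         + (m (k.+1%:R * h) - m (k%:R * h)) * eps.
    rewrite -mulrDr; apply: ler_wpM2l; first by rewrite subr_ge0.
    have -> : eps = C * (k.+1%:R * h - k%:R * h).
      by rewrite -mulrBl -natrB// subSnn mul1r.
    by rewrite -lerBlDl.
  near=> u.
  have : `|J (k%:R * h) - p u (k%:R * h)| <= m (k%:R * h) * eps + eta / 2.
    by near: u; apply: IH => //; exact: ltnW.
  have [] : (m (k.+1%:R * h) - m (k%:R * h)) * g (k.+1%:R * h) - eta / 2
        <= p u (k.+1%:R * h) - p u (k%:R * h) /\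
     p u (k.+1%:R * h) - p u (k%:R * h)
        <= (m (k.+1%:R * h) - m (k%:R * h)) * g (k%:R * h) + eta / 2.
    by near: u; apply: Hp => //; exact: hs.
  set M1 := m (k.+1%:R * h) in hm hg' hJ1 hJ2 *; set M0 := m (k%:R * h) in hm hg' hJ1 hJ2 *.
  rewrite mulrBl in hg'.
  move: hg' hJ1 hJ2.
  set A := (M1 - M0) * _; set B := (M1 - M0) * g (k.+1%:R * h).
  rewrite !ler_norml => ? ? ? ? ? /andP[? ?]; apply/andP; split; lra.
have Ns : N.+1%:R * h = s by rewrite /h mulrC divfK// gt_eqF.
have := H N.+1 (leqnn _) (e / 2); rewrite Ns divr_gt0// => /(_ isT).
apply: filterS => u /le_trans; apply.
suff : m s * eps <= e / 2 by lra.
rewrite /eps /h; have -> : m s * (C * (s / N.+1%:R)) = C * s * m s / N.+1%:R.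
  by ring.
by rewrite ler_pdivrMr// [leRHS]mulrC.
Unshelve. all: by end_near. Qed.

End stieltjes.

(** * Trigonometric and geometric growth estimates *)

Section trigonometry.
Context {R : realType}.

Lemma derive_quotient_at_right (g : R -> R) (l : R) :
  is_derive (0 : R) 1 g l -> g 0 = 0 -> g x / x @[x --> 0^'+] --> l.
Proof.
move=> [dg gl] g0.
have : h^-1 *: (g (h *: (1:R) + 0) - g 0) @[h --> 0^'] --> l.
  by rewrite -gl; exact: dg.
move=> H; have {}H : h^-1 *: (g (h *: (1:R) + 0) - g 0) @[h --> 0^'+] --> l.
  exact: cvg_dnbhs_at_right.
apply: near_eq_cvg_to H; near=> x.
by rewrite g0 subr0 addr0 /GRing.scale/= mulr1 mulrC.
Unshelve. all: by end_near. Qed.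

(** As 1 - cos y = 2 sin^2 (y/2), only the derivative of sin at 0 matters. *)
Lemma sec_expansion (s : R) :
  ((cos (s * x))^-1 - 1) / x ^+ 2 @[x --> 0^'+] --> s ^+ 2 / 2.
Proof.
have d : is_derive (0 : R) 1 (fun x : R => sin (s / 2 * x)) (s / 2).
  apply: is_derive_eq; rewrite mulr0 cos0.
  by rewrite /GRing.scale/= !mulr1 mul1r.
have H := derive_quotient_at_right d.
rewrite mulr0 sin0 in H; have {}H := H erefl.
have cos1 : cos (s * x) @[x --> 0^'+] --> (1 : R).
  rewrite -(@cos0 R) -[in X in _ --> X](mulr0 s).
  apply: cvg_at_right_filter; apply: continuous_comp; last exact: continuous_cos.
  exact: mulrl_continuous.
have : 2 * (sin (s / 2 * x) / x * (sin (s / 2 * x) / x)) * (cos (s * x))^-1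
    @[x --> 0^'+] --> 2 * (s / 2 * (s / 2)) * 1^-1.
  apply: cvgM; last by apply: cvgV; [exact: oner_neq0|].
  by apply: cvgM; [exact: cvg_cst|exact: cvgM].
have -> : 2 * (s / 2 * (s / 2)) * 1^-1 = s ^+ 2 / 2 by field.
apply: near_eq_cvg_to; near=> x.
have x0 : x != 0 by rewrite gt_eqF.
have c0 : 0 < cos (s * x) by near: x; apply: (cvgr_gt _ cos1).
have E : cos (s * x) = 1 - 2 * sin (s / 2 * x) ^+ 2.
  have -> : s * x = (s / 2 * x) *+ 2 by rewrite -mulr_natr; field.
  rewrite cos_mulr2n; have := cos2Dsin2 (s / 2 * x).
  by rewrite -mulr_natl; lra.
have -> : 2 * (sin (s / 2 * x) / x * (sin (s / 2 * x) / x)) =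
  (1 - cos (s * x)) / x ^+ 2 by rewrite E; field.
by field; rewrite x0 (gt_eqF c0).
Unshelve. all: by end_near. Qed.

Lemma atan_quotient (b : R) : atan (b * x) / x @[x --> 0^'+] --> b.
Proof.
apply: derive_quotient_at_right; last by rewrite mulr0 atan0.
apply: is_derive_eq; rewrite mulr0 expr0n/= addr0 invr1.
by rewrite mul1r /GRing.scale/= mulr1.
Qed.

(** By the mean value theorem sin (x/2) >= (x/2) cos (pi/4), whence
cos x <= 1 - x^2/4. *)
Lemma cos_quadratic_bound (x : R) : 0 <= x -> x <= pi / 2 ->
  cos x * (1 + x ^+ 2 / 4) <= 1.
Proof.
move=> x0 xpi; have pi0 := @pi_gt0 R.
suff H : cos x <= 1 - x ^+ 2 / 4.
  have q0 : 0 <= x ^+ 2 / 4 by rewrite divr_ge0 ?sqr_ge0.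
  apply: (@le_trans _ _ ((1 - x ^+ 2 / 4) * (1 + x ^+ 2 / 4))).
    by apply: ler_wpM2r => //; rewrite addr_ge0.
  by nra.
have [->|xn0] := eqVneq x 0; first by rewrite cos0 expr0n/= mul0r subr0.
have {xn0}x0 : 0 < x by rewrite lt_neqAle eq_sym xn0.
have [c] : exists2 c, c \in `]0, (x / 2)[ & sin (x / 2) - sin 0 = cos c * (x / 2 - 0).
  apply: MVT => //; first by rewrite divr_gt0.
  by apply: continuous_subspaceT; exact: continuous_sin.
rewrite in_itv/= sin0 !subr0 => /andP[c0 cx] sE.
have c4 : cos (pi / 4) ^+ 2 = 1 / 2 :> R.
  have : cos (pi / 4 *+ 2) = 0 :> R.
    by rewrite -cos_pihalf; congr cos; rewrite -mulr_natr; field.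
  by rewrite cos_mulr2n -mulr_natl; lra.
have cc : cos (pi / 4) <= cos c.
  rewrite ltW// ltr_cos ?in_itv/=; [lra|apply/andP; split; lra|apply/andP; split; lra].
have c40 : 0 <= cos (pi / 4) :> R.
  by apply: cos_ge0_pihalf; apply/andP; split; lra.
have -> : cos x = 1 - 2 * sin (x / 2) ^+ 2.
  have {1}-> : x = (x / 2) *+ 2 by rewrite -mulr_natr; field.
  rewrite cos_mulr2n; have := cos2Dsin2 (x / 2).
  by rewrite -mulr_natl; lra.
rewrite sE; have : 1 / 2 <= cos c ^+ 2 by rewrite -c4 ler_sqr ?nnegrE// (le_trans c40).
rewrite exprMn => h; have : 0 <= (x / 2) ^+ 2 by rewrite sqr_ge0.
move=> h2; have -> : x ^+ 2 / 4 = (x / 2) ^+ 2 by field.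
by nra.
Qed.

Lemma cos_lt (x th : R) : 0 <= x -> x < th -> th < pi -> cos th < cos x.
Proof.
move=> x0 xth thpi; rewrite ltr_cos// in_itv/=; apply/andP; split; lra.
Qed.

Lemma expr_unbounded (c A : R) : 1 < c -> exists n : nat, A <= c ^+ n.
Proof.
move=> c1; have d0 : 0 < c - 1 by rewrite subr_gt0.
have bern n : 1 + n%:R * (c - 1) <= c ^+ n.
  elim: n => [|n IH]; first by rewrite mul0r addr0 expr0.
  have n0 : 0 <= n%:R :> R by [].
  rewrite exprS -natr1.
  have h1 : c * (1 + n%:R * (c - 1)) <= c * c ^+ n by rewrite ler_wpM2l//; lra.
  have h2 : 0 <= n%:R * ((c - 1) * (c - 1)) by rewrite mulr_ge0// mulr_ge0 ?(ltW d0).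
  by move: h1 h2; set x := c ^+ n; set y := n%:R; nra.
exists (Num.bound (`|A| / (c - 1))).
have A0 : 0 <= `|A| / (c - 1) by rewrite divr_ge0// ltW.
have := archi_boundP A0; rewrite ltr_pdivrMr// => h.
by have := bern (Num.bound (`|A| / (c - 1))); have := ler_norm A; lra.
Qed.

End trigonometry.

(** * Probabilities of sectors *)

Section real_probability.
Context {R : realType} d (T : measurableType d) (P : probability T R).

Definition prob (A : set T) : R := fine (P A).

Lemma probE (A : set T) : measurable A -> P A = (prob A)%:E.
Proof. by move=> mA; rewrite /prob fineK// fin_num_measure. Qed.

Lemma prob_ge0 (A : set T) : 0 <= prob A.
Proof. exact: fine_ge0. Qed.

Lemma prob_le1 (A : set T) : measurable A -> prob A <= 1.
Proof. by move=> mA; rewrite -lee_fin -probE//; exact: probability_le1. Qed.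

Lemma prob_set0 : prob set0 = 0.
Proof. by rewrite /prob measure0. Qed.

Lemma probU (A B : set T) : measurable A -> measurable B ->
  (forall x, A x -> B x -> False) -> prob (A `|` B) = prob A + prob B.
Proof.
move=> mA mB AB; apply: EFin_inj.
rewrite EFinD -!probE//; last exact: measurableU.
apply: measureU => //; apply/seteqP; split=> x //= [Ax Bx].
exact: (AB x).
Qed.

Lemma prob_le (A B : set T) : measurable A -> measurable B ->
  (forall x, A x -> B x) -> prob A <= prob B.
Proof.
by move=> mA mB AB; rewrite -lee_fin -!probE//; apply: le_measure => //; rewrite inE.
Qed.

Lemma prob_le_ae (A B : set T) : measurable A -> measurable B ->
  {ae P, forall x, A x -> B x} -> prob A <= prob B.
Proof.
move=> mA mB [N [mN N0 HN]].
have ABN x : A x -> (B `|` N) x.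
  move=> Ax; have [Bx|nBx] := pselect (B x); [by left|right].
  by apply: HN => /= /(_ Ax).
apply: (@le_trans _ _ (prob (B `|` N))).
  by apply: prob_le => //; exact: measurableU.
rewrite -lee_fin -!probE//; last exact: measurableU.
by apply: (le_trans (measureU2 _ mB mN)); rewrite /= N0 adde0.
Qed.

Lemma eq_prob_ae (A B : set T) : measurable A -> measurable B ->
  {ae P, forall x, A x <-> B x} -> prob A = prob B.
Proof.
move=> mA mB AB; apply/eqP; rewrite eq_le; apply/andP; split.
- by apply: prob_le_ae => //; apply: filterS AB => x [].
- by apply: prob_le_ae => //; apply: filterS AB => x [].
Qed.

End real_probability.

Section polar.
Context {R : realType} d (T : measurableType d) (P : probability T R).
Context (Rad Th : T -> R) (mRad : measurable_fun [set: T] Rad)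
  (mTh : measurable_fun [set: T] Th).
Local Notation pr := (prob P).

Definition horizontal (s : T) : R := Rad s * cos (Th s).
Definition exceeds (a : R) : set T := horizontal @^-1` `]a, +oo[.
Definition sector (x y : R) : set T := Th @^-1` `]x, y].
Definition radial_tail (a : R) : R := pr (Rad @^-1` `]a, +oo[).
Definition angular_mass (x : R) : R := pr (sector 0 x).

Lemma measurable_preimage (f : T -> R) (A : set R) :
  measurable_fun [set: T] f -> measurable A -> measurable (f @^-1` A).
Proof. by move=> mf mA; rewrite -[X in measurable X]setTI; exact: mf. Qed.

Lemma measurable_horizontal : measurable_fun [set: T] horizontal.
Proof.
apply: measurable_funM => //; apply: measurableT_comp => //.
by apply: continuous_measurable_fun; exact: continuous_cos.
Qed.

Lemma measurable_exceeds a : measurable (exceeds a).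
Proof. by apply: measurable_preimage => //; exact: measurable_horizontal. Qed.

Lemma measurable_sector x y : measurable (sector x y).
Proof. exact: measurable_preimage. Qed.

Let mRadtail a : measurable (Rad @^-1` `]a, +oo[).
Proof. exact: measurable_preimage. Qed.

Let V := angular_mass.
Let G := radial_tail.

Lemma sector_mass (x y : R) : 0 <= x -> x <= y -> pr (sector x y) = V y - V x.
Proof.
move=> x0 xy; rewrite /V /angular_mass.
have -> : sector 0 y = sector 0 x `|` sector x y.
  rewrite /sector -preimage_setU -itv_bndbnd_setU ?bnd_simp//.
rewrite probU; [by rewrite addrC addKr|exact: measurable_sector|exact: measurable_sector|].
move=> s; rewrite /sector/= !in_itv/= => /andP[_ h1] /andP[h2 _].
by move: (le_lt_trans h1 h2); rewrite ltxx.
Qed.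

Lemma angular_mass_le (x y : R) : 0 <= x -> x <= y -> V x <= V y.
Proof. by move=> x0 xy; rewrite -subr_ge0 -sector_mass// prob_ge0. Qed.

Lemma angular_mass0 : V 0 = 0.
Proof.
rewrite /V /angular_mass (_ : sector 0 0 = set0) ?prob_set0//.
by rewrite /sector set_itvoc0 preimage_set0.
Qed.

Context (indep : forall A B : set R, measurable A -> measurable B ->
  (P (Rad @^-1` A `&` Th @^-1` B) = P (Rad @^-1` A) * P (Th @^-1` B))%E).
Context (Rad_gt0 : {ae P, forall s, 0 < Rad s}).
Context (Th_lt_pi : {ae P, forall s, Th s < pi}).

Let indep_sector (r x y : R) : 0 <= x -> x <= y ->
  pr (Rad @^-1` `]r, +oo[ `&` sector x y) = (V y - V x) * G r.
Proof.
move=> x0 xy; apply: EFin_inj; rewrite -probE; last first.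
  by apply: measurableI; [exact: mRadtail|exact: measurable_sector].
rewrite /sector indep//; rewrite mulrC EFinM -(sector_mass x0 xy).
by rewrite -!probE//; exact: measurable_sector.
Qed.

(** Independence factorizes the mass of a sector beyond a radius r. *)
Lemma exceeds_sector_le (a r x y : R) : 0 <= x -> x <= y ->
  (forall q th, 0 < q -> x < th -> th < pi -> a < q * cos th -> r < q) ->
  pr (exceeds a `&` sector x y) <= (V y - V x) * G r.
Proof.
move=> x0 xy H; rewrite -indep_sector//.
apply: prob_le_ae.
- by apply: measurableI; [exact: measurable_exceeds|exact: measurable_sector].
- by apply: measurableI; [exact: mRadtail|exact: measurable_sector].
apply: filterS2 Rad_gt0 Th_lt_pi => s R0 Tpi [].
rewrite /exceeds /sector /horizontal/= !in_itv/= !andbT => h1 /andP[h2 h3].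
by split; [exact: (H _ (Th s))|rewrite h2 h3].
Qed.

Lemma exceeds_sector_ge (a r x y : R) : 0 <= x -> x <= y ->
  (forall q th, 0 < q -> x < th -> th <= y -> r < q -> a < q * cos th) ->
  (V y - V x) * G r <= pr (exceeds a `&` sector x y).
Proof.
move=> x0 xy H; rewrite -indep_sector//.
apply: prob_le_ae.
- by apply: measurableI; [exact: mRadtail|exact: measurable_sector].
- by apply: measurableI; [exact: measurable_exceeds|exact: measurable_sector].
apply: filterS Rad_gt0 => s R0 [].
rewrite /exceeds /sector /horizontal/= !in_itv/= !andbT => h1 /andP[h2 h3].
by split; [exact: H|rewrite h2 h3].
Qed.

Lemma exceeds_sector_split (a x y : R) : 0 <= x -> x <= y ->
  pr (exceeds a `&` sector 0 y) =
  pr (exceeds a `&` sector 0 x) + pr (exceeds a `&` sector x y).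
Proof.
move=> x0 xy.
have mES u v : measurable (exceeds a `&` sector u v).
  by apply: measurableI; [exact: measurable_exceeds|exact: measurable_sector].
rewrite -probU//; last first.
  move=> s [_ +] [_]; rewrite /sector/= !in_itv/= => /andP[_ h1] /andP[h2 _].
  by move: (le_lt_trans h1 h2); rewrite ltxx.
rewrite -setIUr; congr (pr (_ `&` _)).
by rewrite /sector -preimage_setU -itv_bndbnd_setU ?bnd_simp.
Qed.

(** On the sector the radius at which the level a is reached increases with the angle,
from a / cos x to a / cos y. *)
Lemma exceeds_sector_bounds (a x y : R) : 0 < a -> 0 <= x -> x <= y -> y < pi / 2 ->
  (V y - V x) * G (a / cos y) <= pr (exceeds a `&` sector x y) /\
  pr (exceeds a `&` sector x y) <= (V y - V x) * G (a / cos x).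
Proof.
move=> a0 x0 xy ypi; have pi0 := @pi_gt0 R.
have cosp z : 0 <= z -> z <= y -> 0 < cos z.
  by move=> z0 zy; apply: cos_gt0_pihalf; apply/andP; split; lra.
split.
  apply: exceeds_sector_ge => // q th q0 xth thy.
  have cy := cosp y (le_trans x0 xy) (lexx _).
  rewrite ltr_pdivrMr// => h; apply: (lt_le_trans h).
  rewrite ler_pM2l//; move: thy; rewrite le_eqVlt => /predU1P[->//|thy].
  by rewrite ltW//; apply: cos_lt => //; lra.
apply: exceeds_sector_le => // q th q0 xth thpi h.
rewrite ltr_pdivrMr ?cosp//; apply: (lt_le_trans h).
by rewrite ler_pM2l// ltW// cos_lt.
Qed.

End polar.

(** * Exceedances in the upper half plane *)

Section tail_asymptotics.
Context {R : realType} d (T : measurableType d) (P : probability T R).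
Context (Rad Th : T -> R) (mRad : measurable_fun [set: T] Rad)
  (mTh : measurable_fun [set: T] Th).
Context (indep : forall A B : set R, measurable A -> measurable B ->
  (P (Rad @^-1` A `&` Th @^-1` B) = P (Rad @^-1` A) * P (Th @^-1` B))%E).
Context (Rad_gt0 : {ae P, forall s, 0 < Rad s}).
Context (Th_lt_pi : {ae P, forall s, Th s < pi}).
Context (xF : \bar R) (w : R -> R) (b : R) (b_gt0 : 0 < b).
Local Notation pr := (prob P).
Local Notation V := (angular_mass P Th).
Local Notation G := (radial_tail P Rad).
Context (tailG : gumbel_tail xF G w).
Context (V_gt0 : forall x, 0 < x -> 0 < V x).
Context (V_rv : forall c, 0 < c -> V (c * x) / V x @[x --> 0^'+] --> c `^ (2 * b)).
Local Notation FF := (increasing_to xF).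
Local Notation exceeds := (exceeds Rad Th).
Local Notation sector := (sector Th).

Let xF_Ny : (-oo < xF)%E. Proof. exact: lt_trans (endpoint_gt0 tailG). Qed.
Let PF := increasing_to_filter xF_Ny.
#[local] Existing Instance PF.

Local Notation tau := (angle_scale w).

Lemma angle_scale_ge0 u : 0 <= tau u. Proof. exact: sqrtr_ge0. Qed.

Let near_t_gt (A : R) : \forall u \near FF, A < u * w u.
Proof. by move/cvgryPgt : (uw_cvgy tailG); exact. Qed.

Lemma angle_scale_cvg : tau u @[u --> FF] --> 0^'+.
Proof.
move=> A /near_at_right0P[e e0 He].
change (\forall u \near FF, A (tau u)); near=> u.
have t1 : 0 < u * w u by near: u; exact: near_t_gt.
apply: He; first by rewrite sqrtr_gt0 divr_gt0.
rewrite -(@ltr_pXn2r _ 2)// ?nnegrE ?angle_scale_ge0 ?(ltW e0)//.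
rewrite sqr_sqrtr; last by rewrite divr_ge0// ltW.
rewrite ltr_pdivrMr// mulrC -ltr_pdivrMr ?exprn_gt0//.
by near: u; exact: near_t_gt.
Unshelve. all: by end_near. Qed.

Let tau_gt0 : \forall u \near FF, 0 < tau u.
Proof.
have H : 0^'+ [set x : R | 0 < x] by apply/near_at_right0P; exists 1.
exact: (angle_scale_cvg H).
Qed.

Let tau_lt (e : R) : 0 < e -> \forall u \near FF, tau u < e.
Proof.
move=> e0; have H : 0^'+ [set x : R | x < e] by exact: nbhs_right_lt.
exact: (angle_scale_cvg H).
Qed.

Let cvg_tau (f : R -> R) (l : R) :
  f x @[x --> 0^'+] --> l -> f (tau u) @[u --> FF] --> l.
Proof. by move=> fl; exact: (cvg_comp _ _ angle_scale_cvg fl). Qed.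

Let tau_sqr : \forall u \near FF, tau u ^+ 2 * (u * w u) = 1.
Proof.
near=> u; have t1 : 0 < u * w u by near: u; exact: near_t_gt.
by rewrite sqr_sqrtr ?divr_ge0 ?(ltW t1)// divfK// gt_eqF.
Unshelve. all: by end_near. Qed.

Let w_gt0 : \forall u \near FF, 0 < w u.
Proof. by apply: filterS (near_lt_endpoint tailG); exact: (scale_gt0 tailG). Qed.

Lemma angular_mass_scaled (x : R) : 0 <= x ->
  V (x * tau u) / V (tau u) @[u --> FF] --> x `^ (2 * b).
Proof.
rewrite le_eqVlt => /predU1P[<-|x0].
  rewrite powR0 ?mulf_neq0 ?pnatr_eq0 ?gt_eqF//.
  under eq_fun do rewrite mul0r angular_mass0 mul0r.
  exact: cvg_cst.
exact: cvg_tau (V_rv x0).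
Qed.

(** At angle x tau the level is reached at radius u + (a + x^2/2 + o(1)) / w u. *)
Lemma radial_tail_scaled (a x : R) :
  G ((u + a / w u) / cos (x * tau u)) / G u @[u --> FF] --> expR (- (a + x ^+ 2 / 2)).
Proof.
pose q u := a * (cos (x * tau u))^-1 + ((cos (x * tau u))^-1 - 1) / tau u ^+ 2.
have cos1 : cos (x * tau u) @[u --> FF] --> (1 : R).
  apply: (@cvg_tau (fun z => cos (x * z))).
  rewrite -(@cos0 R) -[in X in _ --> X](mulr0 x).
  apply: cvg_at_right_filter; apply: continuous_comp; last exact: continuous_cos.
  exact: mulrl_continuous.
have Hq : q u @[u --> FF] --> a + x ^+ 2 / 2.
  have H1 : a * (cos (x * tau u))^-1 @[u --> FF] --> a * 1^-1.
    by apply: cvgM; [exact: cvg_cst|apply: cvgV => //; exact: oner_neq0].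
  have H2 : ((cos (x * tau u))^-1 - 1) / tau u ^+ 2 @[u --> FF] --> x ^+ 2 / 2.
    exact: (@cvg_tau (fun z => ((cos (x * z))^-1 - 1) / z ^+ 2) _ (@sec_expansion R x)).
  rewrite invr1 mulr1 in H1; exact: cvgD H1 H2.
apply: near_eq_cvg_to (gumbel_uniform tailG Hq); near=> u.
have t2 : tau u ^+ 2 * (u * w u) = 1 by near: u; exact: tau_sqr.
have tau0 : 0 < tau u by near: u; exact: tau_gt0.
have w0 : 0 < w u by near: u; exact: w_gt0.
have c0 : 0 < cos (x * tau u) by near: u; apply: (cvgr_gt _ cos1).
congr (G _ / _).
have -> : q u = a * (cos (x * tau u))^-1 + ((cos (x * tau u))^-1 - 1) * (u * w u).
  by rewrite /q -[in RHS](mulKf (lt0r_neq0 (exprn_gt0 2 tau0)) (u * w u)) t2 mulr1.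
by field; rewrite !gt_eqF.
Unshelve. all: by end_near. Qed.

Local Notation I := (angular_profile b).

Let mES a x y : measurable (exceeds a `&` sector x y).
Proof. by apply: measurableI; [exact: measurable_exceeds|exact: measurable_sector]. Qed.

(** The Stieltjes argument for the mass x^(2b) of angles and the radial factor
e^(-a - x^2/2). *)
Lemma exceedance_sector_limit (a s : R) : 0 <= s ->
  pr (exceeds (u + a / w u) `&` sector 0 (s * tau u)) / (V (tau u) * G u)
    @[u --> FF] --> expR (- a) * I s.
Proof.
move=> s0.
pose p u x := pr (exceeds (u + a / w u) `&` sector 0 (x * tau u)) / (V (tau u) * G u).
pose g x := expR (- (a + x ^+ 2 / 2)) : R.
pose m x := x `^ (2 * b) : R.
apply: (@stieltjes_limit _ _ _ _ p m g (fun x => expR (- a) * I x) s (expR (- a) * s)) => //.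
- by rewrite mulr_ge0// expR_ge0.
- move=> u; rewrite /p mul0r (_ : _ `&` _ = set0) ?prob_set0 ?mul0r//.
  by rewrite /sector set_itvoc0 preimage_set0 setI0.
- by rewrite /angular_profile expr0n/= mul0r lower_gamma0 !mulr0.
- exact: powR_ge0.
- move=> x y x0 xy; apply: ge0_ler_powR; rewrite ?nnegrE//.
    by rewrite mulr_ge0// ltW.
  exact: le_trans xy.
- move=> x y x0 xy ys; rewrite /g !opprD !expRD -mulrBr -mulrA ler_pM2l ?expR_gt0//.
  have h1 : 1 + (x ^+ 2 / 2 - y ^+ 2 / 2) <= expR (x ^+ 2 / 2 - y ^+ 2 / 2).
    exact: expR_ge1Dx.
  have h2 : expR (- (y ^+ 2 / 2)) =
      expR (- (x ^+ 2 / 2)) * expR (x ^+ 2 / 2 - y ^+ 2 / 2).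
    by rewrite -expRD; congr expR; lra.
  have h3 : expR (- (x ^+ 2 / 2)) <= 1.
    by rewrite -[leRHS]expR0 ler_expR oppr_le0 divr_ge0// sqr_ge0.
  have h4 := expR_ge0 (- (x ^+ 2 / 2)).
  have h5 : y ^+ 2 / 2 - x ^+ 2 / 2 <= s * (y - x) by nra.
  have h6 : 0 <= y ^+ 2 / 2 - x ^+ 2 / 2 by nra.
  rewrite h2; apply: le_trans h5; nra.
- move=> x y x0 xy ys; rewrite /g /m -mulrBr !opprD !expRD !(mulrCA _ (expR (- a))).
  have [h1 h2] := angular_profile_increment b_gt0 x0 xy.
  by split; apply: ler_wpM2l; rewrite ?expR_ge0.
- move=> x y e x0 xy ys e0; have y0 := le_trans x0 xy.
  have Vlim : (V (y * tau u) - V (x * tau u)) / V (tau u) @[u --> FF] --> m y - m x.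
    under eq_fun do rewrite mulrBl.
    by apply: cvgB; exact: angular_mass_scaled.
  have lim z : (V (y * tau u) - V (x * tau u)) / V (tau u) *
      (G ((u + a / w u) / cos (z * tau u)) / G u) @[u --> FF] --> (m y - m x) * g z.
    by apply: cvgM => //; exact: radial_tail_scaled.
  near=> u.
  have tau0 : 0 < tau u by near: u; exact: tau_gt0.
  have w0 : 0 < w u by near: u; exact: w_gt0.
  have Vt := V_gt0 tau0.
  have Gu : 0 < G u by near: u; exact: (near_G_gt0 tailG).
  have u0 : 0 < u + a / w u.
    have : - a < u * w u by near: u; exact: near_t_gt.
    by rewrite -ltr_pdivrMr// mulNr -subr_gt0 opprK addrC.
  have ypi : y * tau u < pi / 2.
    have : tau u < pi / 2 / (y + 1).
      by near: u; apply: tau_lt; rewrite !divr_gt0 ?pi_gt0// ltr_wpDl.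
    rewrite ltr_pdivlMr ?ltr_wpDl//; nra.
  have xt0 : 0 <= x * tau u by rewrite mulr_ge0// ltW.
  have xyt : x * tau u <= y * tau u by rewrite ler_pM2r.
  have [h1 h2] := exceeds_sector_bounds mRad mTh indep Rad_gt0 Th_lt_pi u0 xt0 xyt ypi.
  have -> : p u y - p u x =
      pr (exceeds (u + a / w u) `&` sector (x * tau u) (y * tau u)) / (V (tau u) * G u).
    by rewrite /p (exceeds_sector_split P mRad mTh _ xt0 xyt) -mulrBl [_ + _ - _]addrC addKr.
  have VG : 0 < V (tau u) * G u by rewrite mulr_gt0.
  have E z : (V (y * tau u) - V (x * tau u)) / V (tau u) *
      (G ((u + a / w u) / cos (z * tau u)) / G u) =
      (V (y * tau u) - V (x * tau u)) * G ((u + a / w u) / cos (z * tau u)) /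
      (V (tau u) * G u) by field; rewrite !gt_eqF.
  split.
  + apply: (@le_trans _ _ ((V (y * tau u) - V (x * tau u)) / V (tau u) *
      (G ((u + a / w u) / cos (y * tau u)) / G u))).
      by near: u; apply: (cvgr_ge _ (lim y)); rewrite ltrBlDr ltrDl.
    by rewrite E ler_pM2r ?invr_gt0.
  + apply: (@le_trans _ _ ((V (y * tau u) - V (x * tau u)) / V (tau u) *
      (G ((u + a / w u) / cos (x * tau u)) / G u))).
      by rewrite E ler_pM2r ?invr_gt0.
    by near: u; apply: (cvgr_le _ (lim x)); rewrite ltrDl.
Unshelve. all: by end_near. Qed.


Definition wide_sector (x : R) : set T := Th @^-1` `]x, +oo[.

Let mEW a x : measurable (exceeds a `&` wide_sector x).
Proof.
apply: measurableI; first exact: measurable_exceeds.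
exact: measurable_preimage.
Qed.

Let exceeds_sectorB a x y : 0 <= x -> x <= y ->
  pr (exceeds a `&` sector x y) =
  pr (exceeds a `&` sector 0 y) - pr (exceeds a `&` sector 0 x).
Proof.
by move=> x0 xy; rewrite (exceeds_sector_split P mRad mTh _ x0 xy) [RHS]addrC addKr.
Qed.

Let V_nd x y : 0 <= x -> x <= y -> V x <= V y.
Proof. exact: (angular_mass_le P mTh). Qed.

(** Regular variation bounds V (c x) / V x by 3/2 for small x only; beyond the angle th0
the mass is at most 1, which costs the factor 1 / V th0. *)
Let cut_doubling : exists c th0 : R, [/\ 1 < c, 0 < th0 &
  forall (k : nat) x, 0 < x ->
    V (c ^+ k * x) <= (3 / 2) ^+ k * V x / V th0].
Proof.
have b2 : 0 < 2 * b by rewrite mulr_gt0.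
pose c := (5 / 4) `^ (1 / (2 * b)) : R.
have cb : c `^ (2 * b) = 5 / 4.
  by rewrite -powRrM mul1r mulVf ?gt_eqF// powRr1// divr_ge0.
have c0 : 0 < c by rewrite powR_gt0// divr_gt0.
have c1 : 1 < c.
  rewrite ltNge; apply/negP => c1.
  have : c `^ (2 * b) <= 1 `^ (2 * b).
    by apply: ge0_ler_powR; rewrite ?nnegrE ?(ltW b2) ?(ltW c0).
  by rewrite cb powR1; lra.
have [e e0 He] : exists2 e, 0 < e & forall x, 0 < x -> x < e -> V (c * x) / V x <= 3 / 2.
  apply/near_at_right0P; apply: (cvgr_le _ (V_rv c0)); rewrite cb; lra.
pose th0 := e / 2; have th00 : 0 < th0 by rewrite divr_gt0.
pose W x := V (Num.min x th0).
have W0 x : 0 < x -> 0 < W x by move=> x0; apply: V_gt0; rewrite lt_min x0.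
have Wstep x : 0 < x -> W (c * x) <= 3 / 2 * W x.
  move=> x0; rewrite /W; case: (leP x th0) => xth.
    apply: (@le_trans _ _ (V (c * x))).
      by apply: V_nd; rewrite ?ge_min ?lexx// le_min (ltW th00) mulr_ge0// ltW.
    by rewrite -ler_pdivrMr ?V_gt0//; apply: He => //; rewrite (le_lt_trans xth)// /th0; lra.
  rewrite min_r; last by rewrite (le_trans (ltW xth))// ler_peMl// ltW.
  by have := V_gt0 th00; lra.
have Witer k x : 0 < x -> W (c ^+ k * x) <= (3 / 2) ^+ k * W x.
  move=> x0; elim: k => [|k IH]; first by rewrite !expr0 !mul1r.
  rewrite !exprS -[c * _ * _]mulrA -[3 / 2 * _ * _]mulrA; apply: (le_trans (Wstep _ _)).
    by rewrite mulr_gt0// exprn_gt0.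
  by apply: ler_wpM2l => //; rewrite divr_ge0.
have Vth1 : V th0 <= 1 by apply: prob_le1; exact: measurable_sector.
have VW x : 0 < x -> V x <= W x / V th0.
  move=> x0; rewrite /W; case: (leP x th0) => xth.
    by rewrite ler_peMr ?invf_ge1 ?V_gt0// ltW// V_gt0.
  by rewrite divff ?gt_eqF ?V_gt0//; apply: prob_le1; exact: measurable_sector.
have WV x : 0 < x -> W x <= V x.
  by move=> x0; apply: V_nd; rewrite ?ge_min ?lexx// le_min (ltW th00) ltW.
exists c, th0; split=> // k x x0.
have cx0 : 0 < c ^+ k * x by rewrite mulr_gt0// exprn_gt0.
apply: (le_trans (VW _ cx0)); rewrite ler_pM2r ?invr_gt0 ?V_gt0//.
apply: (le_trans (Witer _ _ x0)); apply: ler_wpM2l; last exact: WV.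
by rewrite exprn_ge0// divr_ge0.
Qed.

(** Geometric sectors: in the k-th one the radius exceeds u by at least
(c^k - 1)/(c - 1) mean excesses, which costs 2^-k by [gumbel_geometric], while its
angular mass grows at most like (3/2)^k. *)
Lemma exceedance_wide_sector (a eta : R) : 0 < eta ->
  exists2 B : R, 0 <= B & \forall u \near FF,
    pr (exceeds (u + a / w u) `&` wide_sector (B * tau u)) <= eta * (V (tau u) * G u).
Proof.
move=> eta0; have [c [th0 [c1 th00 Vc]]] := cut_doubling.
have c0 : 0 < c by rewrite (lt_trans _ c1).
have Vth := V_gt0 th00.
have d0 : 0 < c - 1 by rewrite subr_gt0.
(* then (b0 c^k)^2 / 8 >= |a| + (c^k - 1)/(c - 1) for all k *)
pose b0 := 8 * (`|a| + 1 / (c - 1)) + 1.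
have b0a : 8 * (`|a| + 1 / (c - 1)) <= b0 ^+ 2.
  have h : 0 <= 8 * (`|a| + 1 / (c - 1)) by rewrite mulr_ge0// addr_ge0// divr_ge0// ltW.
  by rewrite /b0; move: h; set z := 8 * _ => h; nra.
have b01 : 1 <= b0 by rewrite lerDr mulr_ge0// addr_ge0// divr_ge0// ltW.
have b00 : 0 < b0 by rewrite (lt_le_trans _ b01).
pose L := b0 `^ (2 * b) + 1.
have L0 : 0 < L by rewrite ltr_wpDl// powR_ge0.
(* the cells k >= K contribute at most 4 (3/4)^K, up to a constant *)
have [K HK] := @expr_unbounded R (4 / 3) (6 * L / V th0 / eta) ltac:(lra).
exists (b0 * c ^+ K); first by rewrite mulr_ge0 ?exprn_ge0 ?(ltW b00) ?(ltW c0).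
near=> u.
have tau0 : 0 < tau u by near: u; exact: tau_gt0.
have w0 : 0 < w u by near: u; exact: w_gt0.
have u0 : 0 < u by near: u; exact: (near_arg_gt0 tailG).
have t2 : tau u ^+ 2 * (u * w u) = 1 by near: u; exact: tau_sqr.
have ta : 2 * `|a| < u * w u by near: u; exact: near_t_gt.
have Vt := V_gt0 tau0.
have Gu : 0 < G u by near: u; exact: (near_G_gt0 tailG).
have Vb0 : V (b0 * tau u) <= L * V (tau u).
  rewrite -ler_pdivrMr//; near: u.
  by apply: (cvgr_le _ (angular_mass_scaled (ltW b00))); rewrite ltrDl.
have geo : forall k : nat, G (u + (c ^+ k - 1) / (c - 1) / w u) <= G u / 2 ^+ k.
  by near: u; exact: (gumbel_geometric tailG).
pose s k := b0 * c ^+ k * tau u.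
have s0 k : 0 < s k by rewrite !mulr_gt0// exprn_gt0.
have snd k n : s k <= s (k + n)%N.
  rewrite /s ler_pM2r// ler_pM2l// exprD ler_peMr ?exprn_ege1 ?(ltW c1)//.
  by rewrite exprn_ge0// ltW.
pose D := 3 / 2 * (V (b0 * tau u) / V th0 * G u).
have D0 : 0 <= D.
  by rewrite !mulr_ge0 ?invr_ge0 ?(ltW Vth) ?(ltW Gu) ?prob_ge0.
have cell k : pr (exceeds (u + a / w u) `&` sector (s k) (s k.+1)) <= D * (3 / 4) ^+ k.
  have sk : s k <= s k.+1 by rewrite -addn1.
  apply: (le_trans (@exceeds_sector_le _ _ _ P Rad Th mRad mTh indep Rad_gt0 Th_lt_pi
     (u + a / w u) (u + (c ^+ k - 1) / (c - 1) / w u) _ _ (ltW (s0 k)) sk _)).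
    move=> q th q0 sth thpi h.
    have ck1 : 1 <= c ^+ k by rewrite exprn_ege1// ltW.
    have th0' : 0 < th := lt_trans (s0 k) sth.
    have ua0 : 0 < u + a / w u.
      rewrite -(pmulr_lgt0 _ w0) mulrDl divfK ?gt_eqF//.
      by have := ler_norm (- a); rewrite normrN; have := normr_ge0 a; lra.
    have cth : 0 < cos th by rewrite -(pmulr_rgt0 _ q0) (lt_trans ua0).
    have thpi2 : th <= pi / 2.
      rewrite leNgt; apply/negP => hth; have pi0 := @pi_gt0 R.
      have := @cos_lt R (pi / 2) th _ hth thpi; rewrite cos_pihalf divr_ge0 ?(ltW pi0)//.
      by move=> /(_ isT); rewrite ltNge (ltW cth).
    have cq := cos_quadratic_bound (ltW th0') thpi2.
    have h1 : (u + a / w u) * (1 + th ^+ 2 / 4) < q.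
      have e0 : 0 < 1 + th ^+ 2 / 4 by rewrite ltr_pwDl// divr_ge0// sqr_ge0.
      apply: (@lt_le_trans _ _ (q * cos th * (1 + th ^+ 2 / 4))).
        by rewrite ltr_pM2r.
      by rewrite -mulrA -[leRHS]mulr1 ler_pM2l.
    apply: le_lt_trans h1.
    (* in units of 1/w u the radius exceeds u by a + (s k)^2 t / 8 at least *)
    rewrite -(ler_pM2r w0) mulrDl divfK ?gt_eqF//.
    rewrite [leRHS]mulrAC [(u + a / w u) * w u]mulrDl divfK ?gt_eqF//.
    have h2 : (s k) ^+ 2 <= th ^+ 2 by rewrite ler_sqr ?nnegrE ltW.
    have h3 : (s k) ^+ 2 * (u * w u) = (b0 * c ^+ k) ^+ 2.
      by rewrite /s exprMn -mulrA t2 mulr1.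
    have h4 : 8 * (`|a| + 1 / (c - 1)) * c ^+ k <= (b0 * c ^+ k) ^+ 2.
      rewrite exprMn; apply: ler_pM => //.
      - by rewrite mulr_ge0// addr_ge0// divr_ge0// ltW.
      - by rewrite (le_trans _ ck1).
      - by rewrite expr2 ler_peMr// (le_trans _ ck1).
    have h5 : (b0 * c ^+ k) ^+ 2 <= th ^+ 2 * (u * w u).
      by rewrite -h3 ler_pM2r// mulr_gt0.
    have h6 : (c ^+ k - 1) / (c - 1) <= 1 / (c - 1) * c ^+ k.
      by rewrite [leRHS]mulrC mul1r ler_pM2r ?invr_gt0// gerBl.
    have h7 := ler_norm (- a); rewrite normrN in h7.
    have h8 := normr_ge0 a.
    have h9 : `|a| <= `|a| * c ^+ k by rewrite ler_peMr.
    have h10 : th ^+ 2 * (u * w u) / 2 <= th ^+ 2 * (u * w u + a).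
      have : 0 <= th ^+ 2 by rewrite sqr_ge0.
      move: ta; set t := u * w u; set z := th ^+ 2 => ta z0; nra.
    move: h4 h5 h6 h7 h8 h9 h10.
    set x1 := (c ^+ k - 1) / (c - 1); set x2 := 1 / (c - 1).
    set t := u * w u; set z := th ^+ 2.
    set ck := c ^+ k; set S := (b0 * ck) ^+ 2; set na := `|a|.
    by move=> *; lra.
  apply: (@le_trans _ _ (V (s k.+1) * (G u / 2 ^+ k))).
    apply: ler_pM => //; first by rewrite subr_ge0 V_nd// ltW.
      exact: (tail_ge0 tailG).
    by rewrite gerBl prob_ge0.
  have h := Vc k.+1 (b0 * tau u) (mulr_gt0 b00 tau0).
  have -> : s k.+1 = c ^+ k.+1 * (b0 * tau u) by rewrite /s; ring.
  apply: (@le_trans _ _ ((3 / 2) ^+ k.+1 * V (b0 * tau u) / V th0 * (G u / 2 ^+ k))).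
    by rewrite ler_pM2r// divr_gt0// exprn_gt0.
  rewrite le_eqVlt; apply/orP; left; apply/eqP.
  have -> : (3 / 4) ^+ k = (3 / 2) ^+ k / 2 ^+ k :> R.
    by rewrite -exprVn -exprMn; congr (_ ^+ _); field.
  by rewrite /D exprS; ring.
have cells n : pr (exceeds (u + a / w u) `&` sector (s K) (s (K + n)%N)) <=
    4 * D * ((3 / 4) ^+ K - (3 / 4) ^+ (K + n)).
  elim: n => [|n IH].
    by rewrite addn0 subrr mulr0 exceeds_sectorB ?subrr// ltW.
  have h := cell (K + n)%N; rewrite addnS.
  have sKn : s (K + n)%N <= s (K + n).+1 by rewrite -addn1.
  rewrite (exceeds_sectorB _ (ltW (s0 _)) (le_trans (snd K n) sKn)).
  rewrite (exceeds_sectorB _ (ltW (s0 _)) (snd K n)) in IH.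
  rewrite (exceeds_sectorB _ (ltW (s0 _)) sKn) in h.
  apply: (@le_trans _ _ (4 * D * ((3 / 4) ^+ K - (3 / 4) ^+ (K + n)) + D * (3 / 4) ^+ (K + n))).
    by apply: le_trans (lerD IH h); rewrite [leRHS]addrC addrA subrK.
  rewrite exprS le_eqVlt; apply/orP; left; apply/eqP.
  have id x y z : 4 * x * (y - z) + x * z = 4 * x * (y - 3 / 4 * z) :> R by field.
  exact: id.
have [n Hn] := expr_unbounded (pi / s K) c1.
have sn : pi <= s (K + n)%N.
  have -> : s (K + n)%N = c ^+ n * s K by rewrite /s exprD; ring.
  by rewrite -ler_pdivrMr.
apply: (@le_trans _ _ (pr (exceeds (u + a / w u) `&` sector (s K) (s (K + n)%N)))).
  apply: prob_le_ae => //; apply: filterS Th_lt_pi => x xpi [ex].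
  rewrite /wide_sector /sector/= !in_itv/= andbT => h; split=> //.
  by rewrite h (le_trans (ltW xpi) sn).
apply: (le_trans (cells n)).
apply: (@le_trans _ _ (4 * D * (3 / 4) ^+ K)).
  by apply: ler_wpM2l; [exact: mulr_ge0|rewrite gerBl exprn_ge0].
have q0 : 0 < (3 / 4 : R) ^+ K by rewrite exprn_gt0.
have HK' : 6 * L / V th0 * (3 / 4) ^+ K <= eta.
  have q1 : (4 / 3) ^+ K * (3 / 4) ^+ K = 1 :> R.
    by rewrite -exprMn (_ : 4 / 3 * (3 / 4) = 1) ?expr1n//; field.
  move: HK; rewrite ler_pdivrMr// => /(ler_wpM2r (ltW q0)) /le_trans; apply.
  by rewrite mulrAC q1 mul1r.
apply: (@le_trans _ _ (6 * L / V th0 * (3 / 4) ^+ K * (V (tau u) * G u))); last first.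
  by rewrite ler_pM2r// mulr_gt0.
have -> : 4 * D * (3 / 4) ^+ K = V (b0 * tau u) * (6 / V th0 * (3 / 4) ^+ K * G u).
  by rewrite /D; field; rewrite gt_eqF.
have -> : 6 * L / V th0 * (3 / 4) ^+ K * (V (tau u) * G u) =
  L * V (tau u) * (6 / V th0 * (3 / 4) ^+ K * G u) by ring.
by rewrite ler_pM2r// !mulr_gt0 ?invr_gt0.
Unshelve. all: by end_near. Qed.


Lemma exceeds_wide_split (a x y : R) : x <= y ->
  pr (exceeds a `&` wide_sector x) =
  pr (exceeds a `&` sector x y) + pr (exceeds a `&` wide_sector y).
Proof.
move=> xy; rewrite -probU//; last first.
  move=> s [_ +] [_]; rewrite /sector /wide_sector/= !in_itv/= andbT => /andP[_ h1] h2.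
  by move: (le_lt_trans h1 h2); rewrite ltxx.
rewrite -setIUr; congr (pr (_ `&` _)).
by rewrite /sector /wide_sector -preimage_setU -itv_bndbnd_setU ?bnd_simp.
Qed.

(** The tail estimate leaves no room for the angular masses to escape, whence the
incomplete Gamma function is bounded. *)
Lemma lower_gamma_bounded : exists M, forall x, 0 <= x -> lower_gamma b x <= M.
Proof.
have [B B0 HB] := @exceedance_wide_sector 0 1 ltr01.
have c0 : 0 < 2 `^ b * b by rewrite mulr_gt0// powR_gt0.
exists ((I B + 1) / (2 `^ b * b)) => x x0.
rewrite ler_pdivlMr// mulrC.
pose s := Num.max B (Num.sqrt (2 * x)).
have s0 : 0 <= s by rewrite le_max B0.
have xs : x <= s ^+ 2 / 2.
  rewrite ler_pdivlMr// mulrC -(@sqr_sqrtr R (2 * x)); last by rewrite mulr_ge0.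
  by rewrite ler_sqr ?nnegrE ?sqrtr_ge0// le_max lexx orbT.
apply: (@le_trans _ _ (I s)).
  by rewrite /angular_profile; apply: ler_wpM2l; [exact: ltW|exact: lower_gamma_le].
have := @exceedance_sector_limit 0 s s0; have := @exceedance_sector_limit 0 B B0.
rewrite oppr0 expR0 !mul1r => HlB Hls.
have HlB1 : pr (exceeds (u + 0 / w u) `&` sector 0 (B * tau u)) / (V (tau u) * G u) + 1
    @[u --> FF] --> I B + 1 by apply: cvgD => //; exact: cvg_cst.
apply: (ler_cvg_to Hls HlB1); near=> u.
have tau0 : 0 < tau u by near: u; exact: tau_gt0.
have Vt := V_gt0 tau0.
have Gu : 0 < G u by near: u; exact: (near_G_gt0 tailG).
have VG : 0 < V (tau u) * G u by rewrite mulr_gt0.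
have H1 : pr (exceeds (u + 0 / w u) `&` wide_sector (B * tau u)) <= 1 * (V (tau u) * G u).
  by near: u.
rewrite mul1r in H1; rewrite -[1](divff (lt0r_neq0 VG)) -mulrDl ler_pM2r ?invr_gt0//.
have Bs : B * tau u <= s * tau u by rewrite ler_pM2r// le_max lexx.
rewrite (exceeds_sector_split P mRad mTh _ _ Bs); last by rewrite mulr_ge0 ?(ltW tau0).
rewrite lerD2l; apply: le_trans H1; rewrite (exceeds_wide_split _ Bs).
by rewrite lerDl prob_ge0.
Unshelve. all: by end_near. Qed.

Lemma angular_profile_cvg : I s @[s --> +oo] --> total_profile b.
Proof.
have [M HM] := lower_gamma_bounded.
apply: cvgM; first exact: cvg_cst.
apply: (@cvg_comp _ _ _ (fun s : R => s ^+ 2 / 2) (lower_gamma b) _ (pinfty_nbhs R)).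
  apply: gt0_cvgMly; [by rewrite invr_gt0|exact: cvgr_expr2].
exact: lower_gamma_cvg HM.
Qed.

Lemma angular_profile_le_total s : 0 <= s -> I s <= total_profile b.
Proof.
move=> s0; have s20 : 0 <= s ^+ 2 / 2 by rewrite divr_ge0 ?sqr_ge0.
apply: (cvgr_to_ge angular_profile_cvg); near=> x.
have sx : s <= x by near: x; apply: nbhs_pinfty_ge; exact: num_real.
rewrite /angular_profile; apply: ler_wpM2l.
  by rewrite mulr_ge0 ?powR_ge0 ?(ltW b_gt0).
apply: lower_gamma_le => //.
by rewrite ler_pM2r// ler_sqr ?nnegrE// (le_trans s0).
Unshelve. all: by end_near. Qed.

Lemma total_profile_gt0 : 0 < total_profile b.
Proof.
apply: lt_le_trans (angular_profile_le_total (ler01 : (0:R) <= 1)).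
rewrite /angular_profile !mulr_gt0 ?powR_gt0//.
by apply: lower_gamma_gt0; rewrite // expr1n divr_gt0.
Qed.

(** All but a small part of the mass is carried by a sector of angle s tau. *)
Lemma exceedance_limit (a : R) :
  pr (exceeds (u + a / w u) `&` wide_sector 0) / (V (tau u) * G u)
    @[u --> FF] --> expR (- a) * total_profile b.
Proof.
apply/cvgrPdist_le => e e0.
have e4 : 0 < e / 4 by rewrite divr_gt0.
have [B B0 HB] := @exceedance_wide_sector a (e / 4) e4.
have [S HS] : exists S : R, forall s, S <= s -> `|total_profile b - I s| <= e / 4 / expR (- a).
  have : \forall s \near (pinfty_nbhs R), `|total_profile b - I s| <= e / 4 / expR (- a).
    by apply: (cvgr_dist_le _ _ angular_profile_cvg); rewrite divr_gt0 ?expR_gt0.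
  move=> [S [_ HS]]; exists (S + 1) => s Ss; apply: HS.
  by rewrite (lt_le_trans _ Ss)// ltrDl.
pose s := Num.max B S.
have s0 : 0 <= s by rewrite le_max B0.
have HI : `|total_profile b - I s| <= e / 4 / expR (- a).
  by apply: HS; rewrite le_max lexx orbT.
near=> u.
have tau0 : 0 < tau u by near: u; exact: tau_gt0.
have Vt := V_gt0 tau0.
have Gu : 0 < G u by near: u; exact: (near_G_gt0 tailG).
have VG : 0 < V (tau u) * G u by rewrite mulr_gt0.
have H1 : pr (exceeds (u + a / w u) `&` wide_sector (B * tau u)) / (V (tau u) * G u) <= e / 4.
  by rewrite ler_pdivrMr//; near: u.
have H2 : `|expR (- a) * I s - pr (exceeds (u + a / w u) `&` sector 0 (s * tau u)) /
    (V (tau u) * G u)| <= e / 4.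
  by near: u; apply: (cvgr_dist_le _ _ (exceedance_sector_limit s0)).
have Bs : B * tau u <= s * tau u by rewrite ler_pM2r// le_max lexx.
have s0t : 0 <= s * tau u by rewrite mulr_ge0// ltW.
rewrite (exceeds_wide_split _ s0t) mulrDl.
have H3 : pr (exceeds (u + a / w u) `&` wide_sector (s * tau u)) / (V (tau u) * G u) <= e / 4.
  apply: le_trans H1; rewrite ler_pM2r ?invr_gt0// (exceeds_wide_split _ Bs).
  by rewrite lerDr prob_ge0.
have H4 : 0 <= pr (exceeds (u + a / w u) `&` wide_sector (s * tau u)) / (V (tau u) * G u).
  by rewrite divr_ge0 ?prob_ge0 ?(ltW VG).
have H5 : `|expR (- a) * total_profile b - expR (- a) * I s| <= e / 4.
  rewrite -mulrBr normrM ger0_norm ?expR_ge0// mulrC -ler_pdivlMr ?expR_gt0//.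
move: H2 H3 H4 H5.
set x1 := pr (exceeds (u + a / w u) `&` sector _ _) / _.
set x2 := pr (exceeds (u + a / w u) `&` wide_sector _) / _.
set x3 := expR _ * I s; set x4 := _ * total_profile b; clearbody x1 x2 x3 x4.
rewrite !ler_norml => /andP[? ?] ? ? /andP[? ?]; apply/andP; split; lra.
Unshelve. all: by end_near. Qed.

End tail_asymptotics.

(** * Both half planes and the second coordinate *)

Section profile_continuity.
Context {R : realType} (b : R) (b_gt0 : 0 < b).
Local Notation I := (angular_profile b).

Let I_increment (x y : R) : 0 <= x -> x <= y ->
  0 <= I y - I x /\ I y - I x <= y `^ (2 * b) - x `^ (2 * b).
Proof.
move=> x0 xy; have [h1 h2] := angular_profile_increment b_gt0 x0 xy.
have m0 : 0 <= y `^ (2 * b) - x `^ (2 * b).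
  rewrite subr_ge0; apply: ge0_ler_powR; rewrite ?nnegrE ?mulr_ge0 ?(ltW b_gt0)//.
  exact: le_trans xy.
split; first by apply: le_trans h1; rewrite mulr_ge0 ?expR_ge0.
apply: (le_trans h2); rewrite ler_piMr//.
by rewrite -[leRHS]expR0 ler_expR oppr_le0 divr_ge0 ?sqr_ge0.
Qed.

Let I_dist (x y : R) : 0 <= x -> 0 <= y ->
  `|I y - I x| <= `|y `^ (2 * b) - x `^ (2 * b)|.
Proof.
move=> x0 y0; have [xy|/ltW yx] := leP x y.
  have [h1 h2] := I_increment x0 xy.
  by rewrite !ger0_norm// (le_trans h1).
have [h1 h2] := I_increment y0 yx.
by rewrite distrC [leRHS]distrC !ger0_norm// (le_trans h1).
Qed.

Let abs_powR_cvg (z : R) : `|x| `^ (2 * b) @[x --> z] --> `|z| `^ (2 * b).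
Proof.
have b2 : 0 < 2 * b by rewrite mulr_gt0.
have [->|z0] := eqVneq z 0; last first.
  have H : `|x| @[x --> z] --> `|z| by exact: (@norm_continuous _ R).
  have nz0 : 0 < `|z| by rewrite normr_gt0.
  exact: (cvg_comp _ _ H (@powR_continuous R (2 * b) _ nz0)).
rewrite normr0 powR0 ?gt_eqF//; apply/cvgrPdist_le => e e0.
near=> x; rewrite sub0r normrN ger0_norm ?powR_ge0//.
have -> : e = (e `^ (2 * b)^-1) `^ (2 * b).
  by rewrite -powRrM mulVf ?gt_eqF// powRr1// ltW.
apply: ge0_ler_powR; rewrite ?nnegrE ?(ltW b2) ?powR_ge0//.
near: x; have p0 : 0 < e `^ (2 * b)^-1 by rewrite powR_gt0.
exists (e `^ (2 * b)^-1) => //= x /=; rewrite sub0r normrN => /ltW.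
exact.
Unshelve. all: by end_near. Qed.

Let I_abs_cvg (z : R) : I `|x| @[x --> z] --> I `|z|.
Proof.
apply/cvgrPdist_le => e e0; near=> x.
apply: (le_trans (I_dist _ _)) => //; near: x.
exact: (cvgr_dist_le _ _ (@abs_powR_cvg z)).
Unshelve. all: by end_near. Qed.

Let profile_ge0 (x : R) : 0 <= x -> half_plane_profile b x = total_profile b + I `|x|.
Proof. by move=> x0; rewrite /half_plane_profile x0 ger0_norm. Qed.

Let profile_lt0 (x : R) : x < 0 -> half_plane_profile b x = total_profile b - I `|x|.
Proof. by move=> x0; rewrite /half_plane_profile leNgt x0/= ltr0_norm. Qed.

Lemma half_plane_profile_continuous (z : R) :
  half_plane_profile b x @[x --> z] --> half_plane_profile b z.
Proof.
have cT : total_profile b @[x --> z] --> total_profile b by exact: cvg_cst.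
have [z0|z0|z0] := ltgtP z 0.
- rewrite profile_lt0//; apply: near_eq_cvg_to (cvgB cT (@I_abs_cvg z)).
  by near=> x; rewrite /= ?fctE profile_lt0//; near: x; exact: lt_nbhsl.
- rewrite profile_ge0 ?ltW//; apply: near_eq_cvg_to (cvgD cT (@I_abs_cvg z)).
  by near=> x; rewrite /= ?fctE profile_ge0// ltW//; near: x; exact: lt_nbhsr.
- have := @I_abs_cvg z; rewrite z0 normr0.
  have I0 : I 0 = 0 by rewrite /angular_profile expr0n/= mul0r lower_gamma0 mulr0.
  rewrite I0 => H; rewrite profile_ge0 ?lexx// normr0 I0 addr0.
  apply/cvgrPdist_le => e e0; near=> x.
  have : `|0 - (I `|x|)| <= e by near: x; exact: (cvgr_dist_le _ _ H).
  have [x0|x0] := leP 0 x.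
    by rewrite (profile_ge0 x0) opprD addrA subrr.
  by rewrite (profile_lt0 x0) opprB addrCA subrr addr0 sub0r normrN.
Unshelve. all: by end_near. Qed.

End profile_continuity.

Lemma cos_gt0_range (R : realType) (th : R) :
  - pi < th < pi -> 0 < cos th -> - (pi / 2) < th < pi / 2.
Proof.
move=> /andP[th1 th2] c0; have pi0 := @pi_gt0 R.
have H (x : R) : 0 <= x -> x < pi -> 0 < cos x -> x < pi / 2.
  move=> x0 xpi cx; rewrite ltNge le_eqVlt; apply/negP => /predU1P[E|h].
    by move: cx; rewrite -E cos_pihalf ltxx.
  have := @cos_lt R (pi / 2) x _ h xpi; rewrite cos_pihalf divr_ge0 ?(ltW pi0)//.
  by move=> /(_ isT); rewrite ltNge (ltW cx).
have [t0|t0] := leP 0 th.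
  by rewrite (H th)// andbT; lra.
have : - th < pi / 2 by apply: H; rewrite ?cosN//; lra.
by move=> h; apply/andP; split; lra.
Qed.

Section two_sided.
Context {R : realType} d (T : measurableType d) (P : probability T R).
Context (Rad Th : T -> R) (mRad : measurable_fun [set: T] Rad)
  (mTh : measurable_fun [set: T] Th).
Context (indep : forall A B : set R, measurable A -> measurable B ->
  (P (Rad @^-1` A `&` Th @^-1` B) = P (Rad @^-1` A) * P (Th @^-1` B))%E).
Context (Rad_gt0 : {ae P, forall s, 0 < Rad s}).
Context (Th_range : {ae P, forall s, - pi < Th s < pi}).
Context (xF : \bar R) (w : R -> R) (b : R) (b_gt0 : 0 < b).
Local Notation pr := (prob P).
Local Notation nTh := (fun s => - Th s).
Local Notation V := (angular_mass P Th).
Local Notation V' := (angular_mass P nTh).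
Local Notation G := (radial_tail P Rad).
Context (tailG : gumbel_tail xF G w).
Context (V_gt0 : forall x, 0 < x -> 0 < V x).
Context (V_rv : forall c, 0 < c -> V (c * x) / V x @[x --> 0^'+] --> c `^ (2 * b)).
Context (V_sym : forall x, 0 <= x -> x < pi / 2 -> V' x = V x).
Context (atomless : forall c, pr (Th @^-1` [set c]) = 0).
Local Notation FF := (increasing_to xF).
Local Notation tau := (angle_scale w).
Local Notation I := (angular_profile b).
Local Notation exc := (exceeds Rad Th).

Let xF_Ny : (-oo < xF)%E. Proof. exact: lt_trans (endpoint_gt0 tailG). Qed.
Let PF := increasing_to_filter xF_Ny.
#[local] Existing Instance PF.

Let mnTh : measurable_fun [set: T] nTh.
Proof. exact: measurable_funN. Qed.

Let nindep (A B : set R) : measurable A -> measurable B ->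
  (P (Rad @^-1` A `&` nTh @^-1` B) = P (Rad @^-1` A) * P (nTh @^-1` B))%E.
Proof.
move=> mA mB.
have mB' : measurable (-%R @^-1` B : set R) by exact: measurable_preimage.
by have := indep mA mB'.
Qed.

Let Th_lt : {ae P, forall s, Th s < pi}.
Proof. by apply: filterS Th_range => s /andP[]. Qed.

Let nTh_lt : {ae P, forall s, - Th s < pi}.
Proof. by apply: filterS Th_range => s /andP[h _]; rewrite ltrNl. Qed.

Let pi2_gt0 : 0 < pi / 2 :> R. Proof. by rewrite divr_gt0 ?pi_gt0. Qed.

Let nV_gt0 x : 0 < x -> 0 < V' x.
Proof.
move=> x0; pose y := Num.min x (pi / 4).
have y0 : 0 < y by rewrite lt_min x0 divr_gt0 ?pi_gt0.
apply: (@lt_le_trans _ _ (V' y)).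
  rewrite V_sym ?V_gt0// ?(ltW y0)// gt_min; apply/orP; right.
  have := @pi_gt0 R; lra.
by apply: angular_mass_le => //; [exact: ltW|rewrite ge_min lexx].
Qed.

Let near_V_sym (c : R) : 0 < c -> \forall x \near 0^'+, V' (c * x) = V (c * x).
Proof.
move=> c0; near=> x; apply: V_sym; first by rewrite mulr_ge0// ltW.
have : x < pi / 2 / c by near: x; apply: nbhs_right_lt; rewrite divr_gt0.
by rewrite ltr_pdivlMr// mulrC.
Unshelve. all: by end_near. Qed.

Let nV_rv c : 0 < c -> V' (c * x) / V' x @[x --> 0^'+] --> c `^ (2 * b).
Proof.
move=> c0; apply: near_eq_cvg_to (V_rv c0); near=> x; congr (_ / _).
  by apply/esym; near: x; exact: near_V_sym.
by apply/esym; rewrite -[x]mul1r; near: x; exact: near_V_sym.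
Unshelve. all: by end_near. Qed.

Let exceedsN a : exceeds Rad nTh a = exc a.
Proof.
rewrite /exceeds (_ : horizontal Rad nTh = horizontal Rad Th)//.
by apply/funext => s; rewrite /horizontal cosN.
Qed.

Definition below (c : R) : set T := Th @^-1` `]-oo, c].

Let mEB a c : measurable (exc a `&` below c).
Proof.
apply: measurableI; first exact: measurable_exceeds.
exact: measurable_preimage.
Qed.

(** For s <= 0 the angle is reflected: the reflected angular mass agrees with V near 0,
and the boundary of the sector carries no mass. *)
Lemma exceedance_below_limit (a s : R) :
  pr (exc (u + a / w u) `&` below (s * tau u)) / (V (tau u) * G u)
    @[u --> FF] --> expR (- a) * half_plane_profile b s.
Proof.
have neg z : z <= 0 ->
  pr (exc (u + a / w u) `&` below (z * tau u)) / (V (tau u) * G u)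
    @[u --> FF] --> expR (- a) * (total_profile b - I (- z)).
  move=> z0; have nz0 : 0 <= - z by rewrite oppr_ge0.
  have H1 := @exceedance_limit _ _ _ P Rad nTh mRad mnTh nindep Rad_gt0 nTh_lt
    xF w b b_gt0 tailG nV_gt0 nV_rv a.
  have H2 := @exceedance_sector_limit _ _ _ P Rad nTh mRad mnTh nindep Rad_gt0 nTh_lt
    xF w b b_gt0 tailG nV_gt0 nV_rv a _ nz0.
  rewrite mulrBr; apply: near_eq_cvg_to (cvgB H1 H2); near=> u; rewrite /= ?fctE.
  have tau0 : 0 <= tau u by exact: angle_scale_ge0.
  have -> : V' (tau u) = V (tau u).
    rewrite -[tau u]mul1r; near: u.
    exact: (angle_scale_cvg tailG (near_V_sym ltr01)).
  rewrite -mulrBl; congr (_ / _).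
  have y0 : 0 <= - z * tau u by rewrite mulr_ge0.
  rewrite (exceeds_wide_split P mRad mnTh _ y0) [_ + _ - _]addrC addKr exceedsN.
  apply: eq_prob_ae => //.
    apply: measurableI; first exact: measurable_exceeds.
    exact: measurable_preimage.
  have mc : measurable (Th @^-1` [set z * tau u]) by exact: measurable_preimage.
  exists (Th @^-1` [set z * tau u]); split => //.
    by rewrite (probE P mc) atomless.
  move=> x /= H; apply: contrapT => ne; apply: H.
  rewrite /wide_sector /below/= !in_itv/= andbT mulNr ltrN2 le_eqVlt.
  by move/eqP/negbTE : ne => ->.
have [s0|s0] := leP 0 s; last first.
  rewrite /half_plane_profile leNgt s0/=; exact: (neg s (ltW s0)).
have H0 := neg 0 (lexx 0).
have H1 := @exceedance_sector_limit _ _ _ P Rad Th mRad mTh indep Rad_gt0 Th_lt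
    xF w b b_gt0 tailG V_gt0 V_rv a _ s0.
have -> : expR (- a) * half_plane_profile b s =
    expR (- a) * (total_profile b - I (- 0)) + expR (- a) * I s.
  have -> : I (- 0) = 0 by rewrite /angular_profile oppr0 expr0n/= mul0r lower_gamma0 mulr0.
  by rewrite /half_plane_profile s0; ring.
apply: near_eq_cvg_to (cvgD H0 H1); near=> u => /=.
rewrite -mulrDl mul0r; congr (_ / _).
have y0 : 0 <= s * tau u by rewrite mulr_ge0// angle_scale_ge0.
rewrite -probU//; last 2 first.
- by apply: measurableI; [exact: measurable_exceeds|exact: measurable_sector].
- move=> x [_ +] [_]; rewrite /below /sector/= !in_itv/= => h1 /andP[h2 _].
  by move: (le_lt_trans h1 h2); rewrite ltxx.
rewrite -setIUr; congr (pr (_ `&` _)).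
by rewrite /below /sector -preimage_setU -itv_bndbnd_setU ?bnd_simp.
Unshelve. all: by end_near. Qed.

Lemma exceedance_total_limit (a : R) :
  pr (exc (u + a / w u)) / (V (tau u) * G u)
    @[u --> FF] --> expR (- a) * (2 * total_profile b).
Proof.
have H0 := @exceedance_below_limit a 0.
have H1 := @exceedance_limit _ _ _ P Rad Th mRad mTh indep Rad_gt0 Th_lt
    xF w b b_gt0 tailG V_gt0 V_rv a.
have -> : expR (- a) * (2 * total_profile b) =
    expR (- a) * half_plane_profile b 0 + expR (- a) * total_profile b.
  rewrite /half_plane_profile lexx /angular_profile expr0n/= mul0r lower_gamma0 mulr0.
  by ring.
apply: near_eq_cvg_to (cvgD H0 H1); near=> u => /=.
rewrite -mulrDl mul0r; congr (_ / _).
rewrite -probU//; last 2 first.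
- by apply: measurableI; [exact: measurable_exceeds|exact: measurable_preimage].
- move=> x [_ +] [_]; rewrite /below /wide_sector/= !in_itv/= andbT => h1 h2.
  by move: (le_lt_trans h1 h2); rewrite ltxx.
rewrite -setIUr -[RHS]/(pr _) -[in RHS](setIT (exc _)); congr (pr (_ `&` _)).
rewrite /below /wide_sector -preimage_setU -itv_bndbnd_setU ?bnd_simp//.
by rewrite set_itvE preimage_setT.
Unshelve. all: by end_near. Qed.



Section joint_limit.
Context (rho x y : R) (rho_lt1 : -1 < rho < 1) (x_gt0 : 0 < x).
Let r := Num.sqrt (1 - rho ^+ 2).

Let r_gt0 : 0 < r.
Proof.
rewrite sqrtr_gt0; case/andP: rho_lt1 => ? ?.
rewrite (_ : 1 - rho ^+ 2 = (1 - rho) * (1 + rho)); last by ring.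
by apply: mulr_gt0; lra.
Qed.

Definition second_coordinate (s : T) : R :=
  rho * (Rad s * cos (Th s)) + Num.sqrt (1 - rho ^+ 2) * (Rad s * sin (Th s)).

Definition joint_event (u : R) : set T :=
  horizontal Rad Th @^-1` `]u, (u + x / w u)] `&`
  second_coordinate @^-1` `]-oo, (rho * u + y * (u * tau u))].

Lemma measurable_second_coordinate : measurable_fun [set: T] second_coordinate.
Proof.
apply: measurable_funD; apply: measurable_funM => //.
  exact: (measurable_horizontal mRad mTh).
apply: measurable_funM => //; apply: measurableT_comp => //.
by apply: continuous_measurable_fun; exact: continuous_sin.
Qed.

Let mH : measurable_fun [set: T] (horizontal Rad Th).
Proof. exact: measurable_horizontal. Qed.

Lemma measurable_joint_event u : measurable (joint_event u).
Proof.
apply: measurableI; apply: measurable_preimage => //.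
exact: measurable_second_coordinate.
Qed.

Let strip u s : set T := horizontal Rad Th @^-1` `]u, (u + x / w u)] `&` below (s * tau u).

Let m_strip u s : measurable (strip u s).
Proof. by apply: measurableI; exact: measurable_preimage. Qed.

Let strip_limit s : pr (strip u s) / (V (tau u) * G u) @[u --> FF]
  --> (1 - expR (- x)) * half_plane_profile b s.
Proof.
have H0 := @exceedance_below_limit 0 s; have H1 := @exceedance_below_limit x s.
rewrite oppr0 expR0 in H0; rewrite mulrBl.
apply: near_eq_cvg_to (cvgB H0 H1); near=> u; rewrite /= ?fctE.
have w0 : 0 < w u.
  by apply: (scale_gt0 tailG); near: u; exact: (near_lt_endpoint tailG).
rewrite mul0r addr0 -mulrBl; congr (_ / _).
have -> : exc u `&` below (s * tau u) =
    strip u s `|` (exc (u + x / w u) `&` below (s * tau u)).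
  rewrite /strip -setIUl; congr (_ `&` _).
  rewrite /exceeds -preimage_setU -itv_bndbnd_setU ?bnd_simp//.
  by rewrite lerDl divr_ge0 ?(ltW x_gt0) ?(ltW w0).
rewrite probU//; last first.
  move=> z [+ _] [+ _]; rewrite /exceeds/= !in_itv/= andbT => /andP[_ h1] h2.
  by move: (le_lt_trans h1 h2); rewrite ltxx.
by rewrite addrK.
Unshelve. all: by end_near. Qed.

(** On the strip the slope of the second coordinate is tan Theta up to a factor
1 + o(1), and tan is asymptotically linear at the scale tau. *)
Let joint_sandwich (eta : R) : 0 < eta -> \forall u \near FF,
  pr (strip u (y / r - eta)) <= pr (joint_event u) <= pr (strip u (y / r + eta)).
Proof.
move=> eta0; pose z := y / r.
have e2 : 0 < eta / 2 by rewrite divr_gt0.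
have at1 := @atan_quotient R (z + eta / 2).
have at2 := @atan_quotient R (z - eta / 2).
have tau_small c : 0 < c -> \forall u \near FF, tau u < c.
  move=> c0; have H : 0^'+ [set t : R | t < c] by exact: nbhs_right_lt.
  exact: (angle_scale_cvg tailG H).
have tau_pos : \forall u \near FF, 0 < tau u.
  have H : 0^'+ [set t : R | 0 < t] by apply/near_at_right0P; exists 1.
  exact: (angle_scale_cvg tailG H).
have tcvg (f : R -> R) (l : R) : f t @[t --> 0^'+] --> l -> f (tau u) @[u --> FF] --> l.
  by move=> fl; exact: (cvg_comp _ _ (angle_scale_cvg tailG) fl).
have {}at1 := tcvg (fun t => atan ((z + eta / 2) * t) / t) _ at1.
have {}at2 := tcvg (fun t => atan ((z - eta / 2) * t) / t) _ at2.
near=> u.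
have u0 : 0 < u by near: u; exact: (near_arg_gt0 tailG).
have w0 : 0 < w u.
  by apply: (scale_gt0 tailG); near: u; exact: (near_lt_endpoint tailG).
have tau0 : 0 < tau u by near: u.
have t2 : tau u ^+ 2 * (u * w u) = 1.
  rewrite sqr_sqrtr ?divr_ge0 ?mulr_ge0 ?(ltW u0) ?(ltW w0)// divfK//.
  by rewrite gt_eqF// mulr_gt0.
have tauB : tau u * (x * (1 + `|y|)) < r * (eta / 2).
  rewrite -ltr_pdivlMr ?mulr_gt0 ?ltr_pwDl//; near: u; apply: tau_small.
  by rewrite !divr_gt0 ?mulr_gt0 ?ltr_pwDl.
have tau1 : tau u < 1 by near: u; exact: tau_small.
have A1 : atan ((z + eta / 2) * tau u) <= (z + eta) * tau u.
  rewrite -ler_pdivrMr//; near: u; apply: (cvgr_le _ at1); lra.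
have A2 : (z - eta) * tau u <= atan ((z - eta / 2) * tau u).
  rewrite -ler_pdivlMr//; near: u; apply: (cvgr_ge _ at2); lra.
have yz : r * z = y by rewrite /z mulrC divfK// gt_eqF.
have key s : 0 < Rad s -> - pi < Th s < pi ->
   u < horizontal Rad Th s -> horizontal Rad Th s <= u + x / w u ->
   (second_coordinate s <= rho * u + y * (u * tau u) -> Th s <= (z + eta) * tau u) /\
   (Th s <= (z - eta) * tau u -> second_coordinate s <= rho * u + y * (u * tau u)).
  move=> R0 Tpi; rewrite /second_coordinate /horizontal -/r.
  set X := Rad s * cos (Th s) => uX Xu.
  have X0 : 0 < X := lt_trans u0 uX.
  have c0 : 0 < cos (Th s) by rewrite -(pmulr_rgt0 _ R0).
  have Tpi2 := cos_gt0_range Tpi c0.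
  have Tatan : Th s = atan (tan (Th s)) by rewrite tanK// in_itv.
  have sE : Rad s * sin (Th s) = X * tan (Th s).
    by rewrite /X /tan -mulrA [cos _ * _]mulrC divfK// gt_eqF.
  set t := tan (Th s) in Tatan sE *; rewrite sE.
  have K : `|(X - u) * (rho + y * tau u)| <= r * X * (eta / 2) * tau u.
    rewrite normrM.
    apply: (@le_trans _ _ (x * (u * tau u ^+ 2) * (1 + `|y|))).
      apply: ler_pM => //.
        rewrite ger0_norm ?subr_ge0 ?(ltW uX)// lerBlDl (le_trans Xu)// lerD2l.
        rewrite ler_pdivrMr// -mulrA -[u * _ * _]mulrA [u * (_ * _)]mulrCA t2.
        by rewrite mulr1.
      apply: (le_trans (ler_normD _ _)); apply: lerD.
        by rewrite ler_norml; case/andP: rho_lt1 => ? ?; apply/andP; split; lra.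
      by rewrite normrM (ger0_norm (ltW tau0)) ler_piMr// ltW.
    have -> : x * (u * tau u ^+ 2) * (1 + `|y|) = tau u * (x * (1 + `|y|)) * (u * tau u).
      by ring.
    have -> : r * X * (eta / 2) * tau u = r * (eta / 2) * (X * tau u) by ring.
    apply: ler_pM; [| |exact: ltW|by rewrite ler_pM2r// ltW].
      by rewrite mulr_ge0 ?(ltW tau0)// mulr_ge0 ?(ltW x_gt0)// addr_ge0.
    by rewrite mulr_ge0 ?(ltW u0) ?(ltW tau0).
  move: K; rewrite ler_norml => /andP[K1 K2].
  have rX : 0 < r * X by rewrite mulr_gt0.
  rewrite (mulrA r X t).
  split=> [h|h].
    have ht : t <= (z + eta / 2) * tau u.
      rewrite -(ler_pM2l rX).
      have -> : r * X * ((z + eta / 2) * tau u) =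
         (r * z) * X * tau u + r * X * (eta / 2) * tau u by ring.
      rewrite yz; move: h K1 K2.
      set a := r * X * t; set a1 := r * X * (eta / 2) * tau u.
      by clearbody a a1 => *; lra.
    by rewrite Tatan (le_trans _ A1)//; exact: le_atan.
  have ht : t <= (z - eta / 2) * tau u.
    rewrite leNgt; apply/negP => /lt_atan; rewrite -Tatan ltNge.
    by rewrite (le_trans h A2).
  move: ht; rewrite -(ler_pM2l rX).
  have -> : r * X * ((z - eta / 2) * tau u) =
     (r * z) * X * tau u - r * X * (eta / 2) * tau u by ring.
  rewrite yz; move: K1 K2.
  set a := r * X * t; set a1 := r * X * (eta / 2) * tau u.
  by clearbody a a1 => *; lra.
apply/andP; split.
  apply: prob_le_ae => //; first exact: measurable_joint_event.
  apply: filterS2 Rad_gt0 Th_range => s R0 Tpi; rewrite /strip /joint_event => -[].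
  rewrite /below /= !in_itv/= => /andP[h1 h2] h3; have [_ k2] := key s R0 Tpi h1 h2.
  by split; [rewrite h1 h2|exact: k2].
apply: prob_le_ae => //; first exact: measurable_joint_event.
apply: filterS2 Rad_gt0 Th_range => s R0 Tpi; rewrite /strip /joint_event => -[].
rewrite /below /= !in_itv/= => /andP[h1 h2] h3; have [k1 _] := key s R0 Tpi h1 h2.
by split; [rewrite h1 h2|exact: k1].
Unshelve. all: by end_near. Qed.

(** The strips of the sandwich have limits which are close to each other because the
profile is continuous. *)
Lemma joint_event_limit : pr (joint_event u) / (V (tau u) * G u) @[u --> FF]
  --> (1 - expR (- x)) * half_plane_profile b (y / r).
Proof.
apply/cvgrPdist_le => e e0.
have H : (1 - expR (- x)) * half_plane_profile b s @[s --> y / r] -->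
    (1 - expR (- x)) * half_plane_profile b (y / r).
  by apply: cvgM; [exact: cvg_cst|exact: half_plane_profile_continuous].
have e2 : 0 < e / 2 by rewrite divr_gt0.
have /cvgrPdist_le/(_ _ e2)[eta /= eta0 Heta] := H.
have h0 : 0 < eta / 2 by rewrite divr_gt0.
have L1 := Heta (y / r - eta / 2); have L2 := Heta (y / r + eta / 2).
rewrite /= opprB addrCA subrr addr0 gtr0_norm// in L1.
rewrite /= opprD addrA subrr sub0r normrN gtr0_norm// in L2.
have he : eta / 2 < eta by lra.
have {}L1 := L1 he; have {}L2 := L2 he.
near=> u.
have tau0 : 0 < tau u.
  near: u; have Hp : 0^'+ [set t : R | 0 < t] by apply/near_at_right0P; exists 1.
  exact: (angle_scale_cvg tailG Hp).
have VG : 0 < V (tau u) * G u.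
  by rewrite mulr_gt0 ?V_gt0//; near: u; exact: (near_G_gt0 tailG).
have /andP[S1 S2] : pr (strip u (y / r - eta / 2)) <= pr (joint_event u) <=
    pr (strip u (y / r + eta / 2)) by near: u; exact: joint_sandwich.
have N1 : `|(1 - expR (- x)) * half_plane_profile b (y / r - eta / 2) -
   pr (strip u (y / r - eta / 2)) / (V (tau u) * G u)| <= e / 2.
  by near: u; apply: (cvgr_dist_le _ _ (@strip_limit _)).
have N2 : `|(1 - expR (- x)) * half_plane_profile b (y / r + eta / 2) -
   pr (strip u (y / r + eta / 2)) / (V (tau u) * G u)| <= e / 2.
  by near: u; apply: (cvgr_dist_le _ _ (@strip_limit _)).
have M1 : pr (strip u (y / r - eta / 2)) / (V (tau u) * G u) <=
    pr (joint_event u) / (V (tau u) * G u) by rewrite ler_pM2r ?invr_gt0.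
have M2 : pr (joint_event u) / (V (tau u) * G u) <=
    pr (strip u (y / r + eta / 2)) / (V (tau u) * G u) by rewrite ler_pM2r ?invr_gt0.
move: L1 L2 N1 N2 M1 M2.
set x0 := pr (joint_event u) / _; set x1 := pr (strip u (_ - _)) / _.
set x2 := pr (strip u (_ + _)) / _.
set y0 := _ * half_plane_profile b (y / r).
set y1 := _ * half_plane_profile b (_ - _); set y2 := _ * half_plane_profile b (_ + _).
clearbody x0 x1 x2 y0 y1 y2; rewrite !ler_norml.
move=> /andP[? ?] /andP[? ?] /andP[? ?] /andP[? ?] ? ?.
by apply/andP; split; lra.
Unshelve. all: by end_near. Qed.

End joint_limit.

End two_sided.

(** * The law of the angle *)

Section angular_density.
Context {R : realType} d (T : measurableType d) (P : probability T R).
Context (Th : T -> R) (mTh : measurable_fun [set: T] Th) (h : R -> R) (b : R).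
Local Notation mu := (@lebesgue_measure R).
Context (h_meas : measurable_fun `]- pi, pi[ h).
Context (h_gt0 : forall x : R, - pi < x < pi -> 0 < h x).
Context (h_sym : forall x : R, 0 <= x < pi / 2 -> h x = h (- x)).
Local Notation k := (h \_ `]- pi, pi[).
Context (dens : has_density P Th k).
Local Notation V := (angular_mass P Th).
Local Notation V' := (angular_mass P (fun s => - Th s)).

Let kE x : - pi < x < pi -> k x = h x.
Proof. by move=> xpi; rewrite patchE mem_set//= in_itv/=. Qed.

Lemma measurable_density : measurable_fun [set: R] k.
Proof. exact/(measurable_restrictT _ _).1. Qed.

Let mkE (D : set R) : measurable_fun D (EFin \o k).
Proof. by apply: measurable_funTS; apply/measurable_EFinP; exact: measurable_density. Qed.

Lemma density_ge0 x : 0 <= k x.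
Proof.
rewrite patchE; case: ifPn => //; rewrite inE/= in_itv/= => xpi.
exact/ltW/h_gt0.
Qed.

Lemma density_gt0 x : 0 < x -> x < pi -> 0 < k x.
Proof.
move=> x0 xpi; have xx : - pi < x < pi.
  by rewrite xpi andbT (lt_trans _ x0)// oppr_lt0 pi_gt0.
by rewrite kE// h_gt0.
Qed.

Lemma angular_mass_integral x : 0 < x ->
  ((V x)%:E = \int[mu]_(s in `]0%R, x]) (k s)%:E)%E.
Proof.
move=> x0; rewrite /angular_mass -probE; last exact: measurable_sector.
exact: dens.
Qed.

Lemma density_atomless c : prob P (Th @^-1` [set c]) = 0.
Proof.
have := dens (measurable_set1 c); rewrite integral_set1 /pushforward => H.
by rewrite /prob H.
Qed.

(** A density with zero integral over ]0, x] would vanish almost everywhere there. *)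
Lemma angular_mass_gt0 x : 0 < x -> 0 < V x.
Proof.
move=> x0; rewrite lt_neqAle prob_ge0 andbT eq_sym; apply/eqP => V0.
have mD : measurable (`]0, x]%classic : set (measurableTypeR R)).
  exact: measurable_itv.
have : ae_eq mu (`]0, x]%classic : set R) (EFin \o k) (cst 0%E).
  apply/(ae_eq_integral_abs mu mD); first exact: mkE.
  rewrite -[RHS](congr1 EFin V0) angular_mass_integral//.
  by apply: eq_integral => s _; rewrite /= ger0_norm// density_ge0.
move=> [N [mN N0 HN]].
pose y := Num.min x (pi / 2).
have pi0 := @pi_gt0 R.
have y0 : 0 < y by rewrite lt_min x0 divr_gt0.
have : (mu (`]0%R, y]%classic : set R) <= mu N)%E.
  apply: le_measure; [by rewrite inE; exact: measurable_itv|by rewrite inE|].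
  move=> s; rewrite /= in_itv/= le_min => /andP[s0 /andP[sx spi]].
  apply: HN => /=; rewrite in_itv/= s0 sx => /(_ isT) [] /eqP.
  by rewrite gt_eqF// density_gt0//; lra.
rewrite N0 lebesgue_measure_itv/= lte_fin y0 sube0.
by rewrite leNgt lte_fin y0.
Qed.

Lemma angular_mass_sym x : 0 <= x -> x < pi / 2 -> V' x = V x.
Proof.
rewrite le_eqVlt => /predU1P[<- _|x0 xpi]; first by rewrite !angular_mass0.
have mN : measurable_fun [set: T] (fun s => - Th s) by exact: measurable_funN.
have pi0 := @pi_gt0 R.
have mD : measurable (`[- x, 0[%classic : set R) by exact: measurable_itv.
apply: EFin_inj; rewrite angular_mass_integral// /angular_mass -probE; last first.
  exact: measurable_sector.
have -> : sector (fun s => - Th s) 0 x = Th @^-1` `[- x, 0[.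
  apply/seteqP; split=> s; rewrite /sector/= !in_itv/= oppr_gt0 lerNl.
    by move=> /andP[-> ->].
  by move=> /andP[-> ->].
have := dens mD; rewrite /pushforward => ->.
transitivity (\int[pushforward mu (-%R : R -> measurableTypeR R)]_(s in `[(- x)%R, 0%R[) (k s)%:E)%E.
  by apply: eq_measure_integral => A mA _; exact/esym/lebesgue_measureN.
rewrite ge0_integral_pushforward//; last 2 first.
- exact: mkE.
- by move=> s _; rewrite lee_fin density_ge0.
have -> : -%R @^-1` (`[- x, 0[%classic : set R) = (`]0, x]%classic : set R).
  apply/seteqP; split=> s /=; rewrite !in_itv/= lerN2 oppr_lt0.
    by move=> /andP[-> ->].
  by move=> /andP[-> ->].
apply: eq_integral => s; rewrite inE/= in_itv/= => /andP[s0 sx].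
have s1 : - pi < s < pi by apply/andP; split; lra.
have s2 : - pi < - s < pi by apply/andP; split; lra.
rewrite /= !kE// -h_sym//; apply/andP; split; lra.
Qed.

Lemma density_regularly_varying (c e : R) : regularly_varying_at0 h e -> 0 < c ->
  k (t * c) / k t @[t --> 0^'+] --> c `^ e.
Proof.
move=> rv c0; apply: near_eq_cvg_to (rv c c0); near=> t.
have pi0 := @pi_gt0 R.
have t0 : 0 < t by [].
have tpi : t < pi by near: t; apply: nbhs_right_lt; exact: pi_gt0.
have tc : t * c < pi.
  by rewrite -ltr_pdivlMr//; near: t; apply: nbhs_right_lt; rewrite divr_gt0// pi_gt0.
have tc0 : 0 < t * c by rewrite mulr_gt0.
by rewrite !kE//; apply/andP; split; lra.
Unshelve. all: by end_near. Qed.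

End angular_density.

(** * The limit law *)

Section gamma_law.
Context {R : realType}.
Local Notation mu := (@lebesgue_measure R).

(** Rescaling reduces the Gamma distribution function with rate q to the incomplete
Gamma function. *)
Lemma gamma_cdf (b q x : R) : 0 < b -> 0 < q -> 0 <= x ->
  (\int[mu]_(v in `]-oo, x]) (gamma_pdf b q v)%:E =
   (lower_gamma b (q * x) / Gamma_fun b)%:E)%E.
Proof.
move=> b0 q0 x0.
have mg (D : set R) : measurable_fun D (fun v : R => v `^ (b - 1) * expR (- v)).
  apply: measurable_funM; first exact: measurable_powRl.
  by apply: measurable_funTS; apply: measurableT_comp.
have G0 : 0 <= Gamma_fun b.
  apply: Rintegral_ge0 => v _.
  by rewrite mulr_ge0 ?powR_ge0 ?expR_ge0.
have mD : measurable (`]0, x]%classic : set (measurableTypeR R)).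
  exact: measurable_itv.
transitivity (\int[mu]_(v in `]0%R, x])
   ((q / Gamma_fun b)%:E * ((q * v) `^ (b - 1) * expR (- (q * v)))%:E))%E.
  rewrite integral_mkcond [RHS]integral_mkcond; apply: eq_integral => v _.
  rewrite !patchE; have [v0|v0] := leP v 0.
    rewrite [in RHS]memNset; last by rewrite /= in_itv/= ltNge v0.
    have -> : gamma_pdf b q v = 0.
      by rewrite /gamma_pdf patchE memNset//= in_itv/= ltNge v0.
    by case: ifP.
  have -> : gamma_pdf b q v = v `^ (b - 1) * expR (- q * v) * q `^ b / Gamma_fun b.
    by rewrite /gamma_pdf patchE mem_set//= in_itv/= v0.
  have -> : (v \in (`]0, x]%classic : set R)) = (v \in (`]-oo, x]%classic : set R)).
    by apply/idP/idP; rewrite !inE/= !in_itv/= v0.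
  case: ifP => // _; rewrite -EFinM; congr EFin.
  rewrite powRM ?(ltW q0) ?(ltW v0)// mulNr -[in LHS](mulr_powRB1 (ltW q0) b0).
  by ring.
rewrite ge0_integralZl_EFin//; last 3 first.
- by move=> v _; rewrite lee_fin mulr_ge0 ?powR_ge0 ?expR_ge0.
- apply/measurable_EFinP; apply: measurable_funTS.
  exact: (measurableT_comp (mg setT) (mulrl_measurable _)).
- by rewrite divr_ge0// ltW.
rewrite mulrC EFinM -muleA mulrC EFinM lower_gammaE//; last by rewrite mulr_ge0// ltW.
congr (_ * _)%E.
rewrite [RHS](@ge0_integral_scale _ q)//; last 2 first.
- by apply/measurable_EFinP; exact: mg.
- by move=> v; rewrite lee_fin mulr_ge0 ?powR_ge0 ?expR_ge0.
congr (_ * _)%E; congr (integral _ _ _).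
apply/seteqP; split=> v; rewrite /= !in_itv/= pmulr_rgt0// ler_pM2l//.
Qed.


Lemma lower_gamma1 (x : R) : 0 <= x -> lower_gamma 1 x = 1 - expR (- x).
Proof.
rewrite le_eqVlt => /predU1P[<-|x0].
  by rewrite lower_gamma0 oppr0 expR0 subrr.
have := exponential_prob_itv0c 1 x0; rewrite /exponential_prob mulN1r => H.
apply: EFin_inj; rewrite EFinB -H lower_gammaE// ?ltW//.
rewrite integral_itv_obnd_cbnd; last first.
  apply/measurable_EFinP; apply: measurable_funM; first exact: measurable_powRl.
  by apply: measurable_funTS; apply: measurableT_comp.
apply: eq_integral => v; rewrite inE/= in_itv/= => /andP[v0 vx].
by rewrite exponential_pdfE// subrr powRr0 !mul1r mulN1r.
Qed.

Lemma Gamma_fun1 : Gamma_fun 1 = 1 :> R.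
Proof.
have H := @lower_gamma_cvg R 1 1 ltr01.
have {}H : lower_gamma 1 x @[x --> +oo] --> (Gamma_fun 1 : R).
  by apply: H => x x0; rewrite lower_gamma1// gerBl expR_ge0.
apply: (cvg_unique _ H) => //.
have : 1 - expR (- x) @[x --> +oo] --> (1 - 0 : R).
  by apply: cvgB; [exact: cvg_cst|exact: cvgr_expR].
rewrite subr0; apply: near_eq_cvg_to; near=> x.
by rewrite lower_gamma1//; near: x; apply: nbhs_pinfty_ge; exact: num_real.
Unshelve. all: by end_near. Qed.

End gamma_law.

Section limit_law.
Context {R : realType} d (S : measurableType d) (Q : probability S R).
Context (Z : S -> R) (mZ : measurable_fun [set: S] Z) (b : R) (b_gt0 : 0 < b).
Context (Gamma_gt0 : 0 < Gamma_fun b).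
Context (Z_sym : equal_in_law Q Z Q (fun s => - Z s)).
Context (Z_dens : has_density Q (fun s => Z s ^+ 2) (gamma_pdf b (1 / 2))).
Local Notation pr := (prob Q).

Let mZ2 : measurable_fun [set: S] (fun s => Z s ^+ 2).
Proof. exact: measurable_funX. Qed.

Let ratio m : lower_gamma b (1 / 2 * m ^+ 2) / Gamma_fun b =
  angular_profile b m / total_profile b.
Proof.
rewrite /angular_profile /total_profile.
have -> : 1 / 2 * m ^+ 2 = m ^+ 2 / 2 by ring.
have c0 : 2 `^ b * b != 0 by rewrite gt_eqF// mulr_gt0// powR_gt0.
by rewrite -[RHS]mulf_div divff// mul1r.
Qed.

(** By symmetry the events Z > m and Z < -m share equally the probability that Z^2
exceeds m^2. *)
Let upper_tail m : 0 <= m ->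
  pr (Z @^-1` `]m, +oo[) = (1 - angular_profile b m / total_profile b) / 2.
Proof.
move=> m0.
pose A := Z @^-1` `]m, +oo[; pose B := Z @^-1` `]-oo, - m[.
pose C := (fun s => Z s ^+ 2) @^-1` `]-oo, m ^+ 2].
have mA : measurable A by exact: measurable_preimage.
have mB : measurable B by exact: measurable_preimage.
have mC : measurable C by exact: measurable_preimage.
have AB : pr A = pr B.
  have mI : measurable (`]m, +oo[%classic : set R) by exact: measurable_itv.
  rewrite /prob; congr fine; have := Z_sym mI; rewrite /pushforward => ->.
  congr (Q _); apply/seteqP; split=> s; rewrite /B/= !in_itv/= andbT; lra.
have C1 : pr C = angular_profile b m / total_profile b.
  rewrite -ratio; apply: EFin_inj; rewrite -probE//.
  rewrite -gamma_cdf ?divr_gt0// ?sqr_ge0//.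
  by apply: Z_dens; exact: measurable_itv.
have : pr [set: S] = 1 by rewrite /prob probability_setT.
have -> : [set: S] = (A `|` B) `|` C.
  apply/seteqP; split=> s // _; rewrite /A /B /C/= !in_itv/= andbT.
  have [h|h] := leP (Z s) m; last by left; left.
  have [h'|h'] := leP (- m) (Z s); last by left; right.
  by right; rewrite -(real_normK (num_real (Z s))) ler_sqr ?nnegrE// ler_norml h' h.
rewrite probU//; last 2 first.
- exact: measurableU.
- move=> s; rewrite /A /B /C/= !in_itv/= andbT => H H'; have {}H : m < `|Z s|.
    by case: H => h; [exact: lt_le_trans h (ler_norm _)|rewrite -normrN; apply: lt_le_trans (ler_norm _); rewrite ltrNr].
  by move: H'; rewrite -(real_normK (num_real (Z s))) leNgt ltr_sqr ?nnegrE// H.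
rewrite probU//; last by move=> s; rewrite /A /B/= !in_itv/= andbT => h1 h2; lra.
by rewrite -AB C1 -/A; lra.
Qed.

Lemma symmetric_gamma_cdf (z : R) :
  pr (Z @^-1` `]-oo, z]) = half_plane_profile b z / (2 * total_profile b).
Proof.
have t0 : total_profile b != 0.
  by rewrite gt_eqF// /total_profile !mulr_gt0// powR_gt0.
rewrite /half_plane_profile; have [z0|z0] := leP 0 z.
  have mA : measurable (Z @^-1` `]z, +oo[) by exact: measurable_preimage.
  have mB : measurable (Z @^-1` `]-oo, z]) by exact: measurable_preimage.
  have : pr [set: S] = 1 by rewrite /prob probability_setT.
  have -> : [set: S] = (Z @^-1` `]-oo, z]) `|` (Z @^-1` `]z, +oo[).
    rewrite -preimage_setU -itv_bndbnd_setU ?bnd_simp//.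
    by rewrite set_itvE preimage_setT.
  rewrite probU//; last by move=> s /=; rewrite !in_itv/= andbT => h1 h2; lra.
  rewrite upper_tail// => h.
  have -> : pr (Z @^-1` `]-oo, z]) = 1 - (1 - angular_profile b z / total_profile b) / 2.
    by lra.
  by field.
pose m := - z; have m0 : 0 <= m by rewrite oppr_ge0 ltW.
have mA : measurable (Z @^-1` `]-oo, z]) by exact: measurable_preimage.
have mB : measurable (Z @^-1` `]m, +oo[) by exact: measurable_preimage.
have mC : measurable ((fun s => Z s ^+ 2) @^-1` [set m ^+ 2]).
  exact: measurable_preimage.
have C0 : pr ((fun s => Z s ^+ 2) @^-1` [set m ^+ 2]) = 0.
  have := Z_dens (measurable_set1 (m ^+ 2)); rewrite integral_set1 /pushforward => H.
  by rewrite /prob H.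
have mI : measurable (`]-oo, z]%classic : set R) by exact: measurable_itv.
have -> : pr (Z @^-1` `]-oo, z]) = pr (Z @^-1` `]m, +oo[).
  have -> : pr (Z @^-1` `]-oo, z]) = pr (Z @^-1` `[m, +oo[).
    rewrite /prob; congr fine; have := Z_sym mI; rewrite /pushforward => ->.
    by congr (Q _); apply/seteqP; split=> s; rewrite /m/= !in_itv/= andbT; lra.
  apply: eq_prob_ae => //; first exact: measurable_preimage.
  exists ((fun s => Z s ^+ 2) @^-1` [set m ^+ 2]); split => //.
    by rewrite probE// C0.
  move=> s /= H; have -> // : Z s = m.
  apply: contrapT => /eqP ne; apply: H; rewrite !in_itv/= !andbT le_eqVlt.
  by rewrite eq_sym (negbTE ne).
by rewrite upper_tail// -/m; field.
Qed.

End limit_law.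

(** * Conditional limits at high levels *)

Section distribution_functions.
Context {R : realType} d (T : measurableType d) (P : probability T R).

Lemma one_minus_dfun (X : {RV P >-> R}) (x : R) :
  1 - dfun X x = prob P (X @^-1` `]x, +oo[).
Proof.
have mA : measurable (X @^-1` `]x, +oo[) by exact: measurable_funPTI.
have mB : measurable (X @^-1` `]-oo, x]) by exact: measurable_funPTI.
have H : prob P [set: T] = 1 by rewrite /prob probability_setT.
rewrite -H (_ : [set: T] = (X @^-1` `]-oo, x]) `|` (X @^-1` `]x, +oo[)); last first.
  rewrite -preimage_setU -itv_bndbnd_setU ?bnd_simp//.
  by rewrite set_itvE preimage_setT.
rewrite probU//; last first.
  move=> s /=; rewrite !in_itv/= andbT => h1 h2.
  by move: (le_lt_trans h1 h2); rewrite ltxx.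
by rewrite addrC addKr.
Qed.

Lemma gumbel_tail_of_mda (X : {RV P >-> R}) (w : R -> R) (xF : \bar R) :
  xF = upper_endpoint (dfun X) -> (0 < xF)%E -> dfun X 0 = 0 ->
  (forall u, (u%:E < xF)%E -> 0 < w u) -> gumbel_mda (dfun X) w ->
  gumbel_tail xF (radial_tail P X) w.
Proof.
move=> xFE xF0 X0 w0 mda.
have GE x : radial_tail P X x = 1 - dfun X x by rewrite one_minus_dfun.
have G_ni x y : x <= y -> radial_tail P X y <= radial_tail P X x.
  move=> xy; apply: prob_le; [exact: measurable_funPTI|exact: measurable_funPTI|].
  by move=> s /=; rewrite !in_itv/= !andbT; exact: le_lt_trans.
split=> //.
- by move=> u; exact: prob_ge0.
- move=> u; rewrite xFE => /ereal_sup_gt[_ [x /= Fx <-]]; rewrite lte_fin => ux.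
  apply: lt_le_trans (G_ni _ _ (ltW ux)); by rewrite GE subr_gt0.
- move=> u; rewrite GE subr_gt0 xFE => Fu.
  by apply: ereal_sup_ubound; exists u.
- by rewrite GE X0 subr0.
- by move=> x; under eq_fun do rewrite !GE; rewrite xFE; exact: mda.
Qed.

End distribution_functions.

Lemma increasing_sequence (R : realType) (xF : \bar R) (u : nat -> R) :
  (-oo < xF)%E -> (forall n, (1 <= n)%N -> ((u n)%:E < xF)%E) ->
  (u n)%:E @[n --> \oo] --> xF -> u n @[n --> \oo] --> increasing_to xF.
Proof.
move=> xF_Ny hu hlim A /(increasing_toP _ xF_Ny)[x0 x0F HA].
have Hx : \forall n \near \oo, x0 < u n.
  case: xF {xF_Ny hu HA} hlim x0F => [r|H _|//].
  - by move=> /fine_cvgP[_ H]; rewrite lte_fin => x0r; exact: (cvgr_gt _ H).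
  - by move/cvgeyPgt : H => /(_ x0); apply: filterS => n; rewrite lte_fin.
change (\forall n \near \oo, A (u n)); near=> n; apply: HA; first by near: n.
by apply: hu; near: n; exact: nbhs_infty_ge.
Unshelve. all: by end_near. Qed.

Theorem theorem3 (R : realType)
    (d : measure_display) (T : measurableType d) (P : probability T R)
    (X Y : nat -> {RV P >-> R})
    (d' : measure_display) (T' : measurableType d') (P' : probability T' R)
    (Rad Theta : {RV P' >-> R})
    (rho delta : R) (F w h : R -> R) (xF : \bar R)
    (hrho : -1 < rho < 1)
    (hXY : forall n : nat, (1 <= n)%N ->
       equal_in_law P (fun t => (X n t, Y n t))
         P' (fun t => (Rad t * cos (Theta t),
                       rho * (Rad t * cos (Theta t))
                       + Num.sqrt (1 - rho ^+ 2) * (Rad t * sin (Theta t)))))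
    (hRad_gt0 : {ae P', forall t, 0 < Rad t})
    (hF : F = dfun Rad)
    (hxF : xF = upper_endpoint F)
    (hindep : independent_rv P' Rad Theta)
    (hTheta : {ae P', forall t, - pi < Theta t < pi})
    (hh_meas : measurable_fun `]- pi, pi[ h)
    (hh_dens : has_density P' Theta (h \_ `]- pi, pi[))
    (hh_gt0 : forall x : R, - pi < x < pi -> 0 < h x)
    (hh_sym : forall x : R, 0 <= x < pi / 2 -> h x = h (- x))
    (hxF_gt0 : (0 < xF)%E)
    (hF0 : F 0 = 0)
    (hw_gt0 : forall u : R, (u%:E < xF)%E -> 0 < w u)
    (hF_mda : gumbel_mda F w)
    (hdelta : -1 < 2 * delta)
    (hh_rv : regularly_varying_at0 h (2 * delta))
    (u : nat -> R)
    (hu : forall n : nat, (1 <= n)%N -> 0 < u n /\ ((u n)%:E < xF)%E)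
    (hu_lim : (u n)%:E @[n --> \oo] --> xF) :
  let t (n : nat) : R := u n * w (u n) in
  ((exists2 eps : nat -> R, eps n @[n --> \oo] --> (0 : R) &
       \forall n \near \oo,
         fine (P [set s | X n s > u n]) =
         (1 + eps n) * (2 `^ (delta + 1 / 2) * Gamma_fun (delta + 1 / 2)
                        * t n `^ (- (1 / 2)) * h (Num.sqrt (1 / t n))
                        * (1 - F (u n))))
   /\ gumbel_mda (dfun (X 1%N)) w)
  /\
  (forall q : nat -> R,
     (forall n : nat, (1 <= n)%N -> 0 < q n) ->
     w (u n) / q n @[n --> \oo] --> +oo ->
     forall e : R, 0 < e ->
       cond_prob P' [set s | q n * `|Rad s * cos (Theta s) - u n| > e]
                    [set s | Rad s * cos (Theta s) > u n]
         @[n --> \oo] --> (0 : R))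
  /\
  (forall (x y : R), 0 < x ->
     forall (dQ : measure_display) (S : measurableType dQ)
            (Q : probability S R) (Z W : {RV Q >-> R}),
       equal_in_law Q Z Q (fun s => - Z s) ->
       has_density Q (fun s => Z s ^+ 2) (gamma_pdf (delta + 1 / 2) (1 / 2)) ->
       has_density Q W (gamma_pdf 1 1) ->
       independent_rv Q Z W ->
       cond_prob P [set s | Y n s <= rho * u n + y * (u n / Num.sqrt (t n))
                            /\ X n s <= u n + x / w (u n)]
                   [set s | X n s > u n]
         @[n --> \oo] -->
       fine (Q [set s | Z s <= y / Num.sqrt (1 - rho ^+ 2) /\ W s <= x])).
Proof.
move=> t.
have [rho1 rho2] := andP hrho.
pose b := delta + 1 / 2.
have b0 : 0 < b by rewrite /b; lra.
have b20 : 0 < 2 * b by rewrite mulr_gt0.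
have bE : 2 * b - 1 = 2 * delta by rewrite /b; field.
have mR : measurable_fun [set: T'] Rad by exact: measurable_funP.
have mTh : measurable_fun [set: T'] Theta by exact: measurable_funP.
subst F.
have tailG := gumbel_tail_of_mda hxF hxF_gt0 hF0 hw_gt0 hF_mda.
have xF_Ny : (-oo < xF)%E by exact: lt_trans hxF_gt0.
have PF := increasing_to_filter xF_Ny.
pose k := h \_ `]- pi, pi[.
pose V := angular_mass P' Theta.
pose G := radial_tail P' Rad.
pose tau := angle_scale w.
have GE v : G v = 1 - dfun Rad v by rewrite one_minus_dfun.
have mk := measurable_density hh_meas.
have k_ge0 := density_ge0 hh_gt0.
have k_gt0 := density_gt0 hh_gt0.
have V_gt0 := angular_mass_gt0 mTh hh_meas hh_gt0 hh_dens.
have V_int := angular_mass_integral mTh hh_dens.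
have V_sym := angular_mass_sym mTh hh_meas hh_gt0 hh_sym hh_dens.
have atomless := density_atomless hh_dens.
have k_rv s : 0 < s -> k (v * s) / k v @[v --> 0^'+] --> s `^ (2 * b - 1).
  by rewrite bE; exact: density_regularly_varying.
have V_rv : forall c, 0 < c -> V (c * v) / V v @[v --> 0^'+] --> c `^ (2 * b).
  exact: (distribution_regularly_varying mk k_ge0 (pi_gt0 R) k_gt0 V_gt0 V_int k_rv).
have kar : v * k v / V v @[v --> 0^'+] --> 2 * b.
  exact: (karamata mk k_ge0 b20 (pi_gt0 R) k_gt0 V_gt0 V_int k_rv).
have total0 : 0 < total_profile b.
  apply: (@total_profile_gt0 _ _ _ P' Rad Theta mR mTh hindep hRad_gt0 _ xF w b b0 tailG V_gt0 V_rv).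
  by apply: filterS hTheta => s /andP[].
have Gamma0 : 0 < Gamma_fun b.
  by move: total0; rewrite /total_profile pmulr_rgt0// mulr_gt0// powR_gt0.
pose E v := exceeds Rad Theta v.
have mE v : measurable (E v) by exact: measurable_exceeds.
have total_limit a : prob P' (E (v + a / w v)) / (V (tau v) * G v)
    @[v --> increasing_to xF] --> expR (- a) * (2 * total_profile b).
  exact: (exceedance_total_limit mR mTh hindep hRad_gt0 hTheta b0 tailG V_gt0 V_rv V_sym atomless).
have total_limit0 : prob P' (E v) / (V (tau v) * G v)
    @[v --> increasing_to xF] --> 2 * total_profile b.
  have H := total_limit 0; rewrite oppr0 expR0 mul1r in H.
  by apply: near_eq_cvg_to H; apply: nearW => v; rewrite mul0r addr0.
have tau_cvg : tau v @[v --> increasing_to xF] --> 0^'+ by exact: (angle_scale_cvg tailG).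
have tau_pos : \forall v \near increasing_to xF, 0 < tau v.
  have H : 0^'+ [set z : R | 0 < z] by apply/near_at_right0P; exists 1.
  exact: (tau_cvg _ H).
have G_pos : \forall v \near increasing_to xF, 0 < G v by exact: (near_G_gt0 tailG).
have E_pos : \forall v \near increasing_to xF, 0 < prob P' (E v).
  have H : \forall v \near increasing_to xF, 0 < prob P' (E v) / (V (tau v) * G v).
    by apply: (cvgr_gt _ total_limit0); rewrite mulr_gt0.
  near=> v; have h0 : 0 < tau v by near: v.
  have h1 : 0 < G v by near: v.
  have : 0 < prob P' (E v) / (V (tau v) * G v) by near: v.
  by rewrite pmulr_lgt0// invr_gt0 mulr_gt0// V_gt0.
have ratio_limit a : prob P' (E (v + a / w v)) / prob P' (E v)
    @[v --> increasing_to xF] --> expR (- a).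
  have -> : expR (- a) = expR (- a) * (2 * total_profile b) / (2 * total_profile b).
    by rewrite mulfK// gt_eqF// mulr_gt0.
  have H : (prob P' (E v) / (V (tau v) * G v))^-1
      @[v --> increasing_to xF] --> (2 * total_profile b)^-1.
    by apply: cvgV => //; rewrite gt_eqF// mulr_gt0.
  apply: near_eq_cvg_to (cvgM (total_limit a) H); near=> v; rewrite /= ?fctE.
  have h0 : 0 < tau v by near: v.
  have h1 : 0 < G v by near: v.
  have h2 : 0 < prob P' (E v) by near: v.
  have h3 := V_gt0 _ h0.
  by field; rewrite !gt_eqF.
have u_cvg : u n @[n --> \oo] --> increasing_to xF.
  by apply: increasing_sequence => // n /hu[].
have seq_cvg (f : R -> R) (l : R) : f v @[v --> increasing_to xF] --> l ->
    f (u n) @[n --> \oo] --> l.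
  by move=> fl; exact: (cvg_comp _ _ u_cvg fl).
have seq_near (A : set R) : (\forall v \near increasing_to xF, A v) ->
    \forall n \near \oo, A (u n).
  by move=> HA; exact: (u_cvg _ HA).
have law n (B : set (R * R)) : (1 <= n)%N -> measurable B ->
    prob P ((fun s => (X n s, Y n s)) @^-1` B) =
    prob P' ((fun s => (horizontal Rad Theta s, second_coordinate Rad Theta rho s)) @^-1` B).
  by move=> n1 mB; rewrite /prob; congr fine; have := hXY n n1; rewrite /equal_in_law /pushforward => H; exact: (H B mB).
have lawX n c : (1 <= n)%N -> prob P (X n @^-1` `]c, +oo[) = prob P' (E c).
  move=> n1; have mB : measurable (`]c, +oo[%classic `*` [set: R] : set (R * R)).
    exact: measurableX.
  have := law n _ n1 mB.
  rewrite (_ : _ @^-1` _ = X n @^-1` `]c, +oo[); last first.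
    by apply/seteqP; split=> s /=; [case|split].
  move=> ->; congr prob.
  by apply/seteqP; split=> s /=; [case|split].
split; [split|split].
(* t^(-1/2) h(t^(-1/2)) is tau h(tau), which Karamata's theorem compares with V(tau) *)
- pose target v := 2 `^ b * Gamma_fun b * tau v * h (tau v) * G v.
  have target_limit : prob P' (E v) / target v @[v --> increasing_to xF] --> (1 : R).
    have H : (tau v * k (tau v) / V (tau v))^-1 @[v --> increasing_to xF] --> (2 * b)^-1.
      apply: cvgV; first by rewrite gt_eqF.
      exact: (cvg_comp _ _ tau_cvg kar).
    have H2 : (2 `^ b * Gamma_fun b)^-1 @[v --> increasing_to xF] --> (2 `^ b * Gamma_fun b)^-1.
      exact: cvg_cst.
    have p2 : 0 < 2 `^ b :> R by rewrite powR_gt0.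
    have -> : 1 = 2 * total_profile b * (2 * b)^-1 * (2 `^ b * Gamma_fun b)^-1.
      by rewrite /total_profile; field; rewrite !gt_eqF.
    apply: near_eq_cvg_to (cvgM (cvgM total_limit0 H) H2); near=> v; rewrite /= ?fctE.
    have h0 : 0 < tau v by near: v.
    have h1 : 0 < G v by near: v.
    have h3 := V_gt0 _ h0.
    have hpi : tau v < pi.
      near: v; have Hp : 0^'+ [set z : R | z < pi] by apply: nbhs_right_lt; exact: pi_gt0.
      exact: (tau_cvg _ Hp).
    have kh : k (tau v) = h (tau v).
      rewrite /k patchE mem_set//= in_itv/= hpi andbT (lt_trans _ h0)//.
      by rewrite oppr_lt0 pi_gt0.
    have h4 : 0 < h (tau v) by rewrite -kh; exact: k_gt0.
    by rewrite kh /target; field; rewrite !gt_eqF.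
  exists (fun n => prob P' (E (u n)) / target (u n) - 1).
    rewrite -[X in _ --> X](subrr (1 : R)); apply: cvgB; last exact: cvg_cst.
    exact: seq_cvg target_limit.
  have : \forall n \near \oo, 0 < prob P' (E (u n)) / target (u n).
    by apply: (cvgr_gt _ (seq_cvg _ _ target_limit)).
  move=> Hpos; near=> n.
  have n1 : (1 <= n)%N by near: n; exact: nbhs_infty_ge.
  have [un0 unF] := hu _ n1.
  have wn0 := hw_gt0 _ unF.
  have tn0 : 0 < t n by rewrite mulr_gt0.
  have -> : t n `^ (- (1 / 2)) = tau (u n).
    rewrite powRN div1r powR12_sqrt ?ltW// /tau /angle_scale div1r.
    by rewrite sqrtrV// ltW.
  rewrite -[Num.sqrt (1 / t n)]/(tau (u n)) -/b -GE -[_ * G (u n)]/(target (u n)).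
  have tg0 : target (u n) != 0.
    apply/eqP => tg0; have : 0 < prob P' (E (u n)) / target (u n) by near: n.
    by rewrite tg0 invr0 mulr0 ltxx.
  have -> : 1 + (prob P' (E (u n)) / target (u n) - 1) = prob P' (E (u n)) / target (u n).
    by rewrite addrC subrK.
  rewrite divfK// -(lawX n _ n1) /prob; congr (fine (P _)).
  by apply/seteqP; split=> s /=; rewrite in_itv/= andbT.
- have X1E v : 1 - dfun (X 1%N) v = prob P' (E v) by rewrite one_minus_dfun lawX.
  (* an exceedance of v >= 0 implies that the radius exceeds v; conversely
     exceedances have positive probability close to xF *)
  have endpoint : upper_endpoint (dfun (X 1%N)) = xF.
    apply/eqP; rewrite eq_le; apply/andP; split.
      apply: ge_ereal_sup => _ [v /= Hv <-].
      have [v0|v0] := leP 0 v; last first.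
        by rewrite (le_trans _ (ltW hxF_gt0))// lee_fin ltW.
      apply: (tail_endpoint tailG); rewrite lt_neqAle prob_ge0 andbT eq_sym.
      apply/eqP => G0.
      have : prob P' (E v) <= radial_tail P' Rad v.
        apply: prob_le_ae => //; first exact: measurable_preimage.
        apply: filterS hRad_gt0 => s R0.
        rewrite /E /exceeds /horizontal/= !in_itv/= !andbT => h1.
        apply: (lt_le_trans h1); rewrite -[leRHS]mulr1 ler_pM2l// cos_le1.
      by rewrite G0 -X1E leNgt subr_gt0 Hv.
    rewrite leNgt; apply/negP => lt.
    have sup_lt : \forall v \near increasing_to xF, (upper_endpoint (dfun (X 1%N)) < v%:E)%E.
      case: (upper_endpoint (dfun (X 1%N))) lt => [r rF| |_].
      + by apply: filterS (near_gt_lower tailG rF) => v; rewrite lte_fin.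
      + by rewrite ltNge leey.
      + by apply: nearW => v; rewrite ltNyr.
    have [v [h1 h2]] := filter_ex (filterI sup_lt E_pos).
    move: h1; rewrite ltNge => /negP; apply; apply: ereal_sup_ubound.
    by exists v => //=; rewrite -subr_gt0 X1E.
  move=> a; rewrite endpoint; under eq_fun do rewrite !X1E.
  exact: ratio_limit.
(* for every a, eventually e / q n > a / w (u n) *)
- move=> q q0 wq e e0; apply/cvgrPdist_le => eps eps0.
  have [a Ha] : exists a, expR (- a) < eps.
    exists (- ln (eps / 2)); rewrite opprK lnK ?posrE ?divr_gt0//; lra.
  have H1 : \forall n \near \oo, prob P' (E (u n + a / w (u n))) / prob P' (E (u n)) < eps.
    by apply: (cvgr_lt _ (seq_cvg _ _ (ratio_limit a))).
  have H2 : \forall n \near \oo, a / e < w (u n) / q n by move/cvgryPgt : wq; exact.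
  have E_posn := seq_near _ E_pos.
  near=> n; have n1 : (1 <= n)%N by near: n; exact: nbhs_infty_ge.
  have [un0 unF] := hu _ n1.
  have wn0 := hw_gt0 _ unF; have qn0 := q0 _ n1.
  have En : 0 < prob P' (E (u n)) by near: n.
  have EE : [set s | Rad s * cos (Theta s) > u n] = E (u n).
    by apply/seteqP; split=> s; rewrite /E /exceeds /horizontal/= in_itv/= andbT.
  rewrite sub0r normrN /cond_prob EE -!/(prob P' _).
  rewrite ger0_norm ?divr_ge0 ?prob_ge0//.
  have -> : eps = eps * prob P' (E (u n)) / prob P' (E (u n)) by rewrite mulfK// gt_eqF.
  rewrite ler_pM2r ?invr_gt0//.
  have : prob P' (E (u n + a / w (u n))) / prob P' (E (u n)) < eps by near: n.
  rewrite ltr_pdivrMr// => /ltW; apply: le_trans.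
  have aw : a / w (u n) < e / q n.
    have : a / e < w (u n) / q n by near: n.
    rewrite ltr_pdivrMr// mulrAC ltr_pdivlMr// => aq.
    by rewrite ltr_pdivrMr// mulrAC ltr_pdivlMr// [e * _]mulrC.
  have mH : measurable_fun [set: T'] (horizontal Rad Theta) by exact: measurable_horizontal.
  apply: prob_le => //.
    apply: measurableI => //.
    rewrite (_ : [set s | _] = (fun s => q n * `|horizontal Rad Theta s - u n|) @^-1` `]e, +oo[).
      apply: measurable_preimage => //; apply: measurable_funM => //.
      by apply: measurableT_comp => //; apply: measurable_funB.
    by apply/seteqP; split=> s /=; rewrite in_itv/= andbT.
  move=> s; rewrite /E /exceeds /horizontal/= => -[h1]; rewrite !in_itv/= !andbT => h2.
  rewrite gtr0_norm ?subr_gt0// in h1.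
  rewrite -ltr_pdivrMl// in h1.
  rewrite addrC -ltrBrDr; apply: lt_trans h1.
  by rewrite [ltRHS]mulrC.
- move=> x y x0 dQ S Q Z W Zsym Z2 Wd ZW.
  have mZ : measurable_fun [set: S] Z by exact: measurable_funP.
  have Zcdf := symmetric_gamma_cdf mZ b0 Gamma0 Zsym Z2.
  have mI (c : R) : measurable (`]-oo, c]%classic : set R) by exact: measurable_itv.
  have Wcdf : prob Q (W @^-1` `]-oo, x]) = 1 - expR (- x).
    apply: EFin_inj; rewrite -probE; last exact: measurable_funPTI.
    have := Wd _ (mI x); rewrite /pushforward => ->.
    rewrite gamma_cdf ?ltr01 ?(ltW x0)// mul1r Gamma_fun1 divr1.
    by rewrite lower_gamma1 ?(ltW x0).
  have -> : fine (Q [set s | Z s <= y / Num.sqrt (1 - rho ^+ 2) /\ W s <= x]) =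
      half_plane_profile b (y / Num.sqrt (1 - rho ^+ 2)) / (2 * total_profile b)
      * (1 - expR (- x)).
    rewrite -Zcdf -Wcdf (_ : [set s | _] = Z @^-1` `]-oo, (y / Num.sqrt (1 - rho ^+ 2))] `&`
       W @^-1` `]-oo, x]); last by apply/seteqP; split=> s /=; rewrite !in_itv.
    rewrite ZW//; apply: fineM; apply: fin_num_measure; exact: measurable_funPTI.
  have J : prob P' (joint_event Rad Theta w rho x y v) / (V (tau v) * G v)
      @[v --> increasing_to xF] -->
      (1 - expR (- x)) * half_plane_profile b (y / Num.sqrt (1 - rho ^+ 2)).
    exact: (joint_event_limit mR mTh hindep hRad_gt0 hTheta b0 tailG V_gt0 V_rv V_sym
      atomless hrho x0).
  have J2 : prob P' (joint_event Rad Theta w rho x y v) / prob P' (E v)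
      @[v --> increasing_to xF] -->
      (1 - expR (- x)) * half_plane_profile b (y / Num.sqrt (1 - rho ^+ 2)) *
      (2 * total_profile b)^-1.
    have H : (prob P' (E v) / (V (tau v) * G v))^-1
        @[v --> increasing_to xF] --> (2 * total_profile b)^-1.
      by apply: cvgV => //; rewrite gt_eqF// mulr_gt0.
    apply: near_eq_cvg_to (cvgM J H); near=> v; rewrite /= ?fctE.
    have h0 : 0 < tau v by near: v.
    have h1 : 0 < G v by near: v.
    have h2 : 0 < prob P' (E v) by near: v.
    have h3 := V_gt0 _ h0.
    by field; rewrite !gt_eqF.
  rewrite [X in _ --> X](_ : _ =
      (1 - expR (- x)) * half_plane_profile b (y / Num.sqrt (1 - rho ^+ 2)) *
      (2 * total_profile b)^-1); last by ring.
  apply: near_eq_cvg_to (seq_cvg _ _ J2); near=> n.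
  have n1 : (1 <= n)%N by near: n; exact: nbhs_infty_ge.
  rewrite /cond_prob -!/(prob P _).
  have -> : prob P [set s | X n s > u n] = prob P' (E (u n)).
    rewrite -(lawX n _ n1); congr prob.
    by apply/seteqP; split=> s /=; rewrite in_itv/= andbT.
  congr (_ / _).
  pose B : set (R * R) := `]u n, (u n + x / w (u n))] `*` `]-oo, (rho * u n + y * (u n * tau (u n)))].
  have mB : measurable B by exact: measurableX.
  have [un0 unF] := hu _ n1.
  have tn0 : 0 < t n by rewrite mulr_gt0// hw_gt0.
  have tE : u n / Num.sqrt (t n) = u n * tau (u n).
    by rewrite /tau /angle_scale div1r sqrtrV// ltW.
  rewrite -[LHS]/(prob P' _) -(law n B n1 mB); congr prob.
  apply/seteqP; split=> s; rewrite /B/= !in_itv/= tE.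
    by move=> [/andP[h1 h2] h3].
  by move=> [[h1 h2] h3]; rewrite h3 h2.
Unshelve. all: by end_near. Qed.
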